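(* Let $W$ be a finite Weyl group with simple reflections $S$ and let $w\in W$. If $J,K\in\mathsf{BP}(w)$, then $J\cap K\in\mathsf{BP}(w)$ and $J\cup K\in\mathsf{BP}(w)$. In particular, $\mathsf{BP}(w)$, ordered by inclusion, is a distributive lattice.
   Context: For $J\subset S$, $W_J$ is the parabolic subgroup generated by $J$, and $W^J$ is the set of minimal-length representatives of the cosets $W/W_J$. Each $w\in W$ factors uniquely as $w=w^Jw_J$ with $w^J\in W^J$, $w_J\in W_J$. Write $\operatorname{Supp}(w)=\{s\in S\mid s\le w \text{ in Bruhat order}\}$ and $D_L(w)=\{s\in S\mid \ell(sw)<\ell(w)\}$. The decomposition $w=w^Jw_J$ is a Billey--Postnikov (BP) decomposition if $\operatorname{Supp}(w^J)\cap J\subset D_L(w_J)$; $\mathsf{BP}(w)$ is the set of $J\subset S$ for which this holds. *)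

(* Defs.v *)
From mathcomp Require Import all_boot all_order all_algebra all_fingroup.

Set Implicit Arguments.
Unset Strict Implicit.
Unset Printing Implicit Defensive.

Import GRing.Theory Num.Theory.

Section RootSystem.
Local Open Scope ring_scope.
Variables (R : realFieldType) (n : nat).
Implicit Types (u v a b : 'rV[R]_n) (Phi Delta : seq 'rV[R]_n).

Definition dot u v : R := (u *m v^T) 0 0.

Definition cartan b a : R := 2 * dot b a / dot a a.

(* v *m reflection a = v - cartan v a *: a; the matrix is symmetric, so it acts
   in the same way on row and on column vectors. *)
Definition reflection a : 'M[R]_n := 1%:M - (2 / dot a a) *: (a^T *m a).

(* Reduced crystallographic root systems in the Euclidean space R^n. *)
Record root_system Phi : Prop := RootSystem {
  root_span : <<Phi>>%VS = fullv;
  root_neq0 : 0 \notin Phi;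
  root_reduced : forall a (c : R),
    a \in Phi -> c *: a \in Phi -> c = 1 \/ c = -1;
  root_reflection : forall a b,
    a \in Phi -> b \in Phi -> b *m reflection a \in Phi;
  root_integral : forall a b,
    a \in Phi -> b \in Phi -> exists z : int, cartan b a = z%:~R }.

Record root_base Phi Delta : Prop := RootBase {
  base_basis : basis_of fullv Delta;
  base_sub : {subset Delta <= Phi};
  base_sign : forall b, b \in Phi ->
    exists c : 'I_(size Delta) -> nat,
      b = \sum_(i < size Delta) Delta`_i *+ c i \/
      b = - \sum_(i < size Delta) Delta`_i *+ c i }.

(* rho identifies W with the group of matrices generated by all the reflections
   in the roots, and S with the set of reflections in the simple roots. *)
Record weyl_realization Phi Delta (gT : finGroupType)
    (W : {group gT}) (S : {set gT}) (rho : gT -> 'M[R]_n) : Prop :=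
  WeylRealization {
  rho_one : rho 1%g = 1%:M;
  rho_mul : {in W &, {morph rho : x y / (x * y)%g >-> x *m y}};
  rho_inj : {in W &, injective rho};
  rho_onto : forall a, a \in Phi -> exists2 x, x \in W & rho x = reflection a;
  rho_gen : W :=: <<[set x in W | rho x \in map reflection Phi]>>%g;
  rho_simple : S = [set x in W | rho x \in map reflection Delta] }.

End RootSystem.

(* A finite type cannot contain the matrices themselves, so a finite Weyl group
   is a finite group with a faithful realization by such matrices. *)
Definition finite_weyl_group (gT : finGroupType) (W : {group gT})
    (S : {set gT}) : Prop :=
  exists (R : realFieldType) (n : nat) (Phi Delta : seq 'rV[R]_n)
         (rho : gT -> 'M[R]_n),
    [/\ root_system Phi, root_base Phi Delta &
        weyl_realization Phi Delta W S rho].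

Section BilleyPostnikov.
Local Open Scope group_scope.
Variables (gT : finGroupType) (W : {group gT}) (S : {set gT}).
Implicit Types (u v w s : gT) (J : {set gT}).

(* S ^+ k is the set of products of k elements of S.  The bound on k is harmless:
   the partial products of a shortest word are distinct, so a shortest word for
   an element of <<S>> has fewer than #|gT| letters. *)
Definition len w : nat := find (fun k => w \in S ^+ k) (iota 0 #|gT|).

Definition bruhat_step : rel gT := fun u v =>
  (u^-1 * v \in class_support S W) && (len u < len v)%N.

Definition bruhat : rel gT := connect bruhat_step.

Definition Supp w : {set gT} := [set s in S | bruhat s w].

Definition left_descents w : {set gT} := [set s in S | (len (s * w) < len w)%N].

Definition min_reps J : {set gT} :=
  [set v in W | [forall u in v *: <<J>>, (len v <= len u)%N]].

(* w^J; for w in W such a v exists and is unique, so that the default value is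
   not used. *)
Definition min_part J w : gT :=
  odflt 1 [pick v in min_reps J | v^-1 * w \in <<J>>].

(* w_J *)
Definition par_part J w : gT := (min_part J w)^-1 * w.

Definition BP w : {set {set gT}} :=
  [set J : {set gT} | (J \subset S) &&
     (Supp (min_part J w) :&: J \subset left_descents (par_part J w))].

End BilleyPostnikov.

Definition distributive_lattice_by_inclusion (T : finType)
    (F : {set {set T}}) : Prop :=
  exists (d : Order.disp_t) (L : distrLatticeType d)
         (f : {A : {set T} | A \in F} -> L),
    bijective f /\ {mono f : A B / val A \subset val B >-> (A <= B)%O}.

(* Main.v *)
(* Everything is read off from signs of roots: [s] is a left descent of [g] iff [g^-1]
   sends the simple root of [s] to a negative root.

   Put [I = J :&: K] and [w = a u = b v = z h], the decompositions along [J], [K] and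
   [I], so that [z = a x = b y] with [x] in [W_J] and [y] in [W_K].  Split [x = x1 x2]
   with [x1] in [W_P], [P = Supp a], and [x2] minimal in [W_P x2].  As [z] is minimal
   in [z W_I], [x2] is even minimal in [W_P x2 W_K], hence conjugation by [x2] sends
   the letters of [y] into [P].  When [J] is in [BP w], this forces the letters of [y]
   lying in [J] to be left descents of [h].  By symmetry the letters of [x] lying in
   [K] are too, and the remaining letters of [z] lying in [I] are letters of [a]
   that commute with [x]; so [I] is in [BP w].

   For [U = J :|: K], replace [w] by its [W_U]-part.  Then the letters of [y] even
   commute with [x2] and differ from its letters, and symmetrically for [x] and [y2].
   Let [T] be the set of letters of [x] or [y] that lie in [Supp a] and [Supp b].
   Then [z = p x2 y2] with [p] in [W_T] and [x2 y2] minimal in [W_T (x2 y2) W_I].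
   The [W_T]-part of [w] has all of [T] as right descents, so it is the longest
   element of [W_T], and all of [T] are left descents of [w]. *)

From HB Require Import structures.
Require Import Defs.
From mathcomp Require Import all_boot all_order all_algebra all_fingroup.

Set Implicit Arguments.
Unset Strict Implicit.
Unset Printing Implicit Defensive.

Import Order.TTheory GRing.Theory Num.Theory.
Local Open Scope group_scope.

(* The part of the geometric representation that the combinatorics uses, written as a
   right action: [act v g] is [g^-1] applied to [v], and [cf v s] is the coefficient
   of [v] at the simple root [alpha s]. *)
Record geometric_action (gT : finGroupType) (W : {group gT}) (S : {set gT})
    (R : realFieldType) (V : lmodType R) (root : V -> Prop)
    (act : V -> gT -> V) (alpha : gT -> V) (cf : V -> gT -> R) : Prop :=
  GeometricAction {
  ga_gen : W :=: <<S>>;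
  ga_simple_sq : forall s, s \in S -> s * s = 1;
  ga_act_linear : forall g k u v, g \in W ->
    act (k *: u + v)%R g = (k *: act u g + act v g)%R;
  ga_act1 : forall v, act v 1 = v;
  ga_actM : forall v g h, g \in W -> h \in W ->
    act v (g * h) = act (act v g) h;
  ga_cf_linear : forall k u v s, cf (k *: u + v)%R s = (k * cf u s + cf v s)%R;
  ga_cf_eq0 : forall v, (forall s, s \in S -> cf v s = 0%R) -> v = 0%R;
  ga_cf_alpha : forall s t, s \in S -> t \in S ->
    cf (alpha s) t = ((s == t)%:R)%R;
  ga_act_alpha : forall s, s \in S -> act (alpha s) s = (- alpha s)%R;
  ga_cf_act : forall v s t, s \in S -> t \in S -> t != s ->
    cf (act v s) t = cf v t;
  ga_root0 : ~ root 0%R;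
  ga_rootN : forall v, root v -> root (- v)%R;
  ga_root_alpha : forall s, s \in S -> root (alpha s);
  ga_root_act : forall v g, g \in W -> root v -> root (act v g);
  ga_root_sign : forall v, root v ->
    (forall s, s \in S -> (0 <= cf v s)%R) \/
    (forall s, s \in S -> (cf v s <= 0)%R);
  ga_root_multiple : forall v s, root v -> s \in S ->
    (forall t, t \in S -> t != s -> cf v t = 0%R) ->
    v = alpha s \/ v = (- alpha s)%R;
  ga_simple_conj : forall s t g, s \in S -> t \in S -> g \in W ->
    s ^ g = t <-> act (alpha s) g = alpha t \/ act (alpha s) g = (- alpha t)%R }.

(** * Words in a generating set *)

Lemma expset_word (gT : finGroupType) (S : {set gT}) k w :
  reflect (exists2 c, size c = k & {subset c <= S} /\ w = \prod_(s <- c) s)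
          (w \in S ^+ k).
Proof.
apply: (iffP idP).
  elim: k w => [|k IH] w.
    rewrite expg0 => /set1P ->; exists [::] => //.
    by split=> //; rewrite big_nil.
  rewrite expgS => /mulsgP[s v sS /IH[c <- [cS ->]] ->].
  exists (s :: c) => //; split; last by rewrite big_cons.
  by move=> t; rewrite inE => /predU1P[-> | /cS].
elim: k w => [|k IH] w [c].
  by move/size0nil => -> [_ ->]; rewrite big_nil expg0 set11.
case: c => // s c [sz] [cS ->]; rewrite big_cons expgS mem_mulg //.
  by apply: cS; rewrite mem_head.
by apply: IH; exists c => //; split=> // t tc; apply: cS; rewrite inE tc orbT.
Qed.

Lemma gen_word (gT : finGroupType) (J : {set gT}) u :
  u \in <<J>> -> exists2 c, {subset c <= J} & u = \prod_(s <- c) s.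
Proof.
case/gen_prodgP=> k [c cJ ->].
exists [seq c i | i <- index_enum 'I_k].
  by move=> t /mapP[i _ ->].
by rewrite big_map.
Qed.

Lemma word_gen (gT : finGroupType) (J : {set gT}) c :
  {subset c <= J} -> \prod_(s <- c) s \in <<J>>.
Proof.
elim: c => [|s c IH] cJ; first by rewrite big_nil group1.
rewrite big_cons groupM //; first by rewrite mem_gen ?cJ ?mem_head.
by apply: IH => t tc; apply: cJ; rewrite inE tc orbT.
Qed.

Section Theory.
Variables (gT : finGroupType) (W : {group gT}) (S : {set gT}).
Variables (R : realFieldType) (V : lmodType R) (root : V -> Prop).
Variables (act : V -> gT -> V) (alpha : gT -> V) (cf : V -> gT -> R).
Hypothesis ga : geometric_action W S root act alpha cf.
Implicit Types (v : V) (g h s t u : gT) (A B C I J K M N P Q T U X Y : {set gT}).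

Local Notation "v |> g" := (act v g) (at level 40, left associativity).

(** * Signs and supports of roots *)

Definition pos v := [forall s in S, (0 <= cf v s)%R].
Definition supported J v := [forall s in S :\: J, cf v s == 0%R].
(** As [act] applies [g^-1], this says that [g] has no left descent in [J], so [g] is shortest in
    [<<J>> g]; [rmin] is the same for [g <<J>>]. *)
Definition lmin J g := [forall s in J, pos (alpha s |> g)].
Definition rmin J g := lmin J g^-1.

Let S_sub : S \subset W. Proof. by rewrite (ga_gen ga) sub_gen. Qed.
Let S_W s : s \in S -> s \in W. Proof. exact: (subsetP S_sub). Qed.

Lemma gen_sub J : J \subset S -> <<J>> \subset W.
Proof. by move=> JS; rewrite (ga_gen ga) genS. Qed.

Lemma gen_W J g : J \subset S -> g \in <<J>> -> g \in W.
Proof. by move=> /gen_sub/subsetP; apply. Qed.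

Lemma actN v g : g \in W -> - v |> g = (- (v |> g))%R :> V.
Proof.
move=> gW; have h := ga_act_linear ga (-1) v 0 gW.
have h0 := ga_act_linear ga (-1) 0 0 gW.
move: h0; rewrite scaleN1r addr0 oppr0 scaleN1r addNr => a0.
by move: h; rewrite a0 !addr0 !scaleN1r.
Qed.

Lemma cf0 s : cf 0 s = 0%R.
Proof.
by have := ga_cf_linear ga (-1) 0 0 s; rewrite scaler0 addr0 mulN1r addNr.
Qed.

Lemma cfZ k v s : cf (k *: v)%R s = (k * cf v s)%R.
Proof. by have := ga_cf_linear ga k v 0 s; rewrite addr0 cf0 addr0. Qed.

Lemma cfD v v1 s : cf (v + v1)%R s = (cf v s + cf v1 s)%R.
Proof. by have := ga_cf_linear ga 1 v v1 s; rewrite scale1r mul1r. Qed.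

Lemma cfN v s : cf (- v)%R s = (- cf v s)%R.
Proof. by rewrite -scaleN1r cfZ mulN1r. Qed.

Lemma cf_sum (I : eqType) (r : seq I) (F : I -> V) s :
  cf (\sum_(i <- r) F i)%R s = (\sum_(i <- r) cf (F i) s)%R.
Proof.
elim: r => [|i r IH]; first by rewrite !big_nil cf0.
by rewrite !big_cons cfD IH.
Qed.

Lemma cf_inj (v v1 : V) : (forall s, s \in S -> cf v s = cf v1 s) -> v = v1.
Proof.
move=> h; apply/eqP; rewrite -subr_eq0; apply/eqP/(ga_cf_eq0 ga) => s sS.
by rewrite cfD cfN h // subrr.
Qed.

Lemma actZ k v g : g \in W -> (k *: v)%R |> g = (k *: (v |> g))%R.
Proof.
move=> gW; have := ga_act_linear ga k v 0 gW; rewrite !addr0 => ->.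
have := actN 0 gW; rewrite oppr0 => /eqP; rewrite -subr_eq0 opprK -mulr2n.
by rewrite -scaler_nat scaler_eq0 pnatr_eq0 => /eqP ->; rewrite addr0.
Qed.

Lemma actD v v1 g : g \in W -> (v + v1)%R |> g = ((v |> g) + (v1 |> g))%R.
Proof. by move=> gW; have := ga_act_linear ga 1 v v1 gW; rewrite !scale1r. Qed.

Lemma act_sum (I : eqType) (r : seq I) (F : I -> V) g : g \in W ->
  (\sum_(i <- r) F i)%R |> g = (\sum_(i <- r) (F i |> g))%R.
Proof.
move=> gW; elim: r => [|i r IH]; last by rewrite !big_cons actD // IH.
by rewrite !big_nil; have := actZ 0 0 gW; rewrite !scale0r.
Qed.

Lemma actK v g : g \in W -> v |> g |> g^-1 = v.
Proof. by move=> gW; rewrite -(ga_actM ga) ?groupV // mulgV (ga_act1 ga). Qed.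

Lemma actKV v g : g \in W -> v |> g^-1 |> g = v.
Proof. by move=> gW; rewrite -(ga_actM ga) ?groupV // mulVg (ga_act1 ga). Qed.

Lemma supportedP J v :
  reflect (forall s, s \in S -> s \notin J -> cf v s = 0%R) (supported J v).
Proof.
apply: (iffP forall_inP) => h s.
  by move=> sS sJ; apply/eqP/h; rewrite inE sJ.
by rewrite inE => /andP[sJ sS]; apply/eqP/h.
Qed.

Lemma posP v : reflect (forall s, s \in S -> (0 <= cf v s)%R) (pos v).
Proof. exact: forall_inP. Qed.

Lemma lminP J g : reflect {in J, forall s, pos (alpha s |> g)} (lmin J g).
Proof. exact: forall_inP. Qed.

Lemma rminP J g : reflect {in J, forall s, pos (alpha s |> g^-1)} (rmin J g).
Proof. exact: forall_inP. Qed.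

Lemma posN v : root v -> pos (- v)%R = ~~ pos v.
Proof.
move=> rv; apply/idP/idP => [/posP p | n].
  apply/negP => /posP q; apply: (ga_root0 ga); rewrite -(_ : v = 0%R) //.
  apply: (ga_cf_eq0 ga) => s sS; apply/le_anti; rewrite q // andbT.
  by rewrite -oppr_ge0 -cfN p.
case: (ga_root_sign ga rv) => h; first by case/posP: n.
by apply/posP => s sS; rewrite cfN oppr_ge0 h.
Qed.

Lemma pos_alpha s : s \in S -> pos (alpha s).
Proof. by move=> sS; apply/posP => t tS; rewrite (ga_cf_alpha ga) // ler0n. Qed.

Lemma neg_alphaN s : s \in S -> ~~ pos (- alpha s)%R.
Proof.
by move=> sS; rewrite posN ?negbK ?pos_alpha //; apply: (ga_root_alpha ga).
Qed.

Lemma supported_alpha J s : s \in S -> s \in J -> supported J (alpha s).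
Proof.
move=> sS sJ; apply/supportedP => t tS tJ; rewrite (ga_cf_alpha ga) //.
by case: eqP tJ => // <-; rewrite sJ.
Qed.

Lemma supportedN J v : supported J (- v)%R = supported J v.
Proof.
by apply/supportedP/supportedP => h s sS sJ; have := h s sS sJ;
  rewrite cfN => /eqP; rewrite ?oppr_eq0 => /eqP // ->; rewrite oppr0.
Qed.

Lemma supportedS J K v : J \subset K -> supported J v -> supported K v.
Proof.
move=> /subsetP JK /supportedP h; apply/supportedP => s sS sK.
by apply: h => //; apply: contra sK => /JK.
Qed.

Lemma supportedI J K v :
  supported (J :&: K) v = supported J v && supported K v.
Proof.
apply/idP/andP => [h | [/supportedP hJ /supportedP hK]].
  by split; apply: supportedS h; rewrite ?subsetIl ?subsetIr.
apply/supportedP => s sS; rewrite inE negb_and.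
by case/orP => ?; [apply: hJ | apply: hK].
Qed.

Lemma supported_expand J v : J \subset S -> supported J v ->
  v = (\sum_(s in J) cf v s *: alpha s)%R.
Proof.
move=> /subsetP JS /supportedP h; apply: cf_inj => t tS.
rewrite -big_enum cf_sum big_enum /=.
rewrite (eq_bigr (fun s => if s == t then cf v t else 0)%R); last first.
  move=> s sJ; rewrite cfZ (ga_cf_alpha ga) ?(JS _ sJ) //.
  by case: eqP => [->|_]; rewrite ?mulr1 ?mulr0.
case tJ: (t \in J); last first.
  by rewrite h ?tJ // big1 // => s sJ; case: eqP => // e; rewrite -e sJ in tJ.
rewrite (bigD1 t) //= eqxx big1 ?addr0 // => s /andP[_ st].
by rewrite (negPf st).
Qed.

Lemma gen_subset A J x : A \subset J -> x \in <<A>> -> x \in <<J>>.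
Proof. by move=> AJ; apply: subsetP (genS AJ) _. Qed.

(** A simple reflection changes only its own coefficient, so a word over [J] leaves the others
    alone. *)
Lemma cf_gen J u t v :
  J \subset S -> u \in <<J>> -> t \in S -> t \notin J -> cf (v |> u) t = cf v t.
Proof.
move=> /subsetP JS /gen_word[c cJ ->] tS tJ.
elim: c v cJ => [|s c IH] v cJ; first by rewrite big_nil (ga_act1 ga).
have sJ : s \in J by apply: cJ; rewrite mem_head.
have c'J : {subset c <= J} by move=> r rc; apply: cJ; rewrite inE rc orbT.
have cS : {subset c <= S} by move=> r /c'J /JS.
have cW : \prod_(s <- c) s \in W by rewrite (ga_gen ga) word_gen.
have sS := JS _ sJ; have sW := S_W sS.
rewrite big_cons (ga_actM ga) // IH // (ga_cf_act ga) //.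
by apply: contraNneq tJ => ->.
Qed.

Lemma supported_gen J u v : J \subset S -> u \in <<J>> ->
  supported J (v |> u) = supported J v.
Proof.
move=> JS uJ; apply/supportedP/supportedP => h s sS sJ.
  by rewrite -(cf_gen v JS uJ) // h.
by rewrite (cf_gen v JS uJ) // h.
Qed.

Lemma pos_outside J v : root v -> ~~ supported J v ->
  pos v = [exists s in S :\: J, (0 < cf v s)%R].
Proof.
move=> rv /forall_inPn[s /setDP[sS sJ] ns].
apply/posP/exists_inP => [h | [t /setDP[tS _] gt] r rS].
  by exists s; rewrite ?inE ?sJ // lt_neqAle eq_sym ns h.
case: (ga_root_sign ga rv) => [h | /(_ t tS)]; first exact: h.
by rewrite leNgt gt.
Qed.

(** The coefficients of a root agree in sign, so a nonzero one outside [J] decides, and [<<J>>] does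
    not change it. *)
Lemma pos_gen J u v : J \subset S -> u \in <<J>> -> root v ->
  ~~ supported J v -> pos (v |> u) = pos v.
Proof.
move=> JS uJ rv nv; have uW := gen_W JS uJ.
rewrite (pos_outside (J := J)) ?supported_gen ?(pos_outside rv nv) //; last first.
  exact: (ga_root_act ga).
by apply: eq_existsb => s; case: setDP => // -[sS sJ]; rewrite (cf_gen v JS uJ).
Qed.

Lemma supported_alphaN A s : s \in S -> s \notin A -> ~~ supported A (alpha s).
Proof.
move=> sS; apply: contra => /supportedP h; apply: contraT => /(h s sS).
by rewrite (ga_cf_alpha ga) // eqxx => /eqP; rewrite oner_eq0.
Qed.

Lemma pos_alpha_gen A s x : A \subset S -> s \in S -> s \notin A -> x \in <<A>> ->
  pos (alpha s |> x).
Proof.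
move=> AS sS sA xA; rewrite (pos_gen AS) ?pos_alpha ?supported_alphaN //.
exact: (ga_root_alpha ga).
Qed.

(** A root not supported on [s] alone keeps its sign under [s]; a positive root supported there is
    [alpha s]. *)
Lemma pos_simple s v : s \in S -> root v -> pos v -> ~~ pos (v |> s) ->
  v = alpha s.
Proof.
move=> sS rv pv nv.
have sup : supported [set s] v.
  apply: contraR nv => h.
  by rewrite (@pos_gen [set s]) ?sub1set ?mem_gen ?set11.
have /(ga_root_multiple ga rv sS)[//|e] :
    forall t, t \in S -> t != s -> cf v t = 0%R.
  by move=> t tS ts; apply: (supportedP _ _ sup) => //; rewrite inE.
by move: (neg_alphaN sS); rewrite -e pv.
Qed.

(** * Words, length and the exchange condition *)

Lemma simpleV s : s \in S -> s^-1 = s.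
Proof. by move=> sS; apply/eqP; rewrite eq_invg_mul (ga_simple_sq ga). Qed.

Lemma simpleK s g : s \in S -> s * (s * g) = g.
Proof. by move=> sS; rewrite mulgA (ga_simple_sq ga) // mul1g. Qed.

Lemma root_actW g s : g \in W -> s \in S -> root (alpha s |> g).
Proof. by move=> gW sS; apply: (ga_root_act ga) => //; apply: (ga_root_alpha ga). Qed.

Lemma act_alpha_mul s g : s \in S -> g \in W ->
  alpha s |> (s * g) = (- (alpha s |> g))%R.
Proof.
by move=> sS gW; rewrite (ga_actM ga) ?(ga_act_alpha ga) ?actN //; apply: S_W.
Qed.

(* The letter to delete is the one at which the positive root [v] turns negative. *)
Lemma exchange J c v g s :
    J \subset S -> {subset c <= J} -> g \in W -> s \in S -> pos v ->
    v = alpha s |> g \/ v = (- (alpha s |> g))%R ->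
    ~~ pos (v |> \prod_(t <- c) t) ->
  exists c', [/\ {subset c' <= J}, (size c').+1 = size c &
                 \prod_(t <- c') t = s ^ g * \prod_(t <- c) t].
Proof.
move=> JS; elim: c v g => [|r c IH] v g cJ gW sS pv ev.
  by rewrite big_nil (ga_act1 ga) pv.
have rJ : r \in J by apply: cJ; rewrite mem_head.
have c'J : {subset c <= J} by move=> t tc; apply: cJ; rewrite inE tc orbT.
have rS := subsetP JS _ rJ; have rW := S_W rS.
have cW : \prod_(t <- c) t \in W by apply: (gen_W JS); apply: word_gen.
have rv : root v by case: ev => ->; last (apply: (ga_rootN ga)); apply: root_actW.
rewrite big_cons (ga_actM ga) //.
have [pvr | nvr] := boolP (pos (v |> r)) => nv.
  have [||c' [c'J' sz e]] := IH _ (g * r) c'J _ sS pvr _ nv.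
  - exact: groupM.
  - by case: ev => ->; rewrite (ga_actM ga) ?actN //; [left | right].
  exists (r :: c'); split; rewrite /= ?sz //.
    by move=> t; rewrite inE => /predU1P[-> | /c'J'].
  rewrite big_cons e conjgM conjgE (simpleV rS) !mulgA (ga_simple_sq ga) //.
  by rewrite mul1g (conjgE s g) !mulgA.
(* The root turns negative at [r]: then [v] is [alpha r], so [s ^ g] is [r] and multiplying by it
   deletes the first letter. *)
exists c; split => //.
have e : s ^ g = r.
  apply/(ga_simple_conj ga sS rS gW); rewrite -(pos_simple rS rv pv nvr).
  by case: ev => ->; [left | right; rewrite opprK].
by rewrite e simpleK.
Qed.

Lemma len_word c : {subset c <= S} -> (len S (\prod_(s <- c) s)%g <= size c)%N.
Proof.
move=> cS; rewrite leqNgt; apply/negP => lt.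
have szlt : (size c < #|gT|)%N.
  by apply: leq_trans lt _; rewrite /len -{2}(size_iota 0 #|gT|) find_size.
move: (before_find 0 lt); rewrite nth_iota // add0n => /negP[].
by apply/expset_word; exists c.
Qed.

Lemma reduced_word w : w \in W ->
  exists c, [/\ {subset c <= S}, w = \prod_(s <- c) s & size c = len S w].
Proof.
rewrite (ga_gen ga) => /gen_word[c0 c0S e0].
have ex : exists k, w \in S ^+ k by exists (size c0); apply/expset_word; exists c0.
case: (ex_minnP ex) => k /expset_word[c szc [cS e]] kmin.
have klt : (k < #|gT|)%N.
  rewrite -[k.+1]card_ord.
  pose f (i : 'I_k.+1) := \prod_(s <- take i c) s.
  (* If the prefixes of lengths [i] and [j] have the same product, replacing the first by the second
     gives a word of length [j + (k - i)], which is at least [k]. So the prefix products are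
     distinct and [k] is in the range searched by [len]. *)
  suff le : forall i j, f i = f j -> (i <= j)%N.
    apply: (@leq_card _ _ f) => i j fij; apply/val_inj/eqP.
    by rewrite eqn_leq !le.
  move=> i j fij; have : (k <= size (take j c ++ drop i c))%N.
    apply: kmin; apply/expset_word; exists (take j c ++ drop i c) => //.
    split=> [t|]; first by rewrite mem_cat => /orP[/mem_take | /mem_drop]; apply: cS.
    by rewrite e -{1}(cat_take_drop i c) !big_cat /= -/(f i) fij.
  rewrite size_cat size_take size_drop szc.
  have := ltn_ord i; have := ltn_ord j; rewrite !ltnS => jk ik.
  have -> : (if (j < k)%N then j : nat else k) = j.
    by case: ltngtP jk => // ->.
  by rewrite addnBA // leq_subRL ?leq_add2r // (leq_trans ik) ?leq_addl.
have hs : has (fun k => w \in S ^+ k) (iota 0 #|gT|).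
  by apply/hasP; exists k; rewrite ?mem_iota //; apply/expset_word; exists c.
have := nth_find 0 hs; rewrite nth_iota;
  last by rewrite -[X in (_ < X)%N](size_iota 0) -has_find.
by rewrite add0n => /expset_word[c' sz [c'S e']]; exists c'.
Qed.

Lemma len_mul s g : s \in S -> g \in W -> (len S (s * g)%g <= (len S g).+1)%N.
Proof.
move=> sS /reduced_word[c [cS -> <-]].
have := @len_word (s :: c); rewrite big_cons; apply => t.
by rewrite inE => /predU1P[-> | /cS].
Qed.

Lemma lenV g : g \in W -> len S g^-1 = len S g.
Proof.
suff le h : h \in W -> (len S h^-1%g <= len S h)%N.
  by move=> gW; apply/eqP; rewrite eqn_leq le // -{1}[g]invgK le ?groupV.
case/reduced_word=> c [cS -> <-].
suff -> : (\prod_(s <- c) s)^-1 = \prod_(s <- rev c) s.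
  by rewrite -size_rev len_word // => t; rewrite mem_rev => /cS.
elim: c cS => [|s c IH] cS; first by rewrite !big_nil invg1.
have sS : s \in S by apply: cS; rewrite mem_head.
rewrite big_cons invMg rev_cons -cats1 big_cat big_seq1 /= (simpleV sS) IH //.
by move=> t tc; apply: cS; rewrite inE tc orbT.
Qed.

(** If the root turns negative, the exchange lemma drops a letter of a reduced word. For the
    converse pass to [s * w], where the root has the opposite sign. *)
Lemma len_descent s w : s \in S -> w \in W ->
  (len S (s * w)%g < len S w)%N = ~~ pos (alpha s |> w).
Proof.
move=> sS; have half g : g \in W ->
    ~~ pos (alpha s |> g) -> (len S (s * g)%g < len S g)%N.
  case/reduced_word=> c [cS e <-]; rewrite e => n.
  have [|c' [c'S <- e']] := exchange (subxx S) cS (group1 W) sS (pos_alpha sS) _ n.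
    by left; rewrite (ga_act1 ga).
  by rewrite ltnS; move: e'; rewrite conjg1 => <-; apply: len_word.
move=> wW; apply/idP/idP; last exact: half.
apply: contraL => p; rewrite -leqNgt ltnW // -{1}(simpleK w sS).
apply: half; first by rewrite groupM // S_W.
by rewrite act_alpha_mul // posN ?negbK //; apply: root_actW.
Qed.

(* If [u] keeps the simple root of the first letter of a [J]-word for [u] positive,
   the exchange lemma gives a shorter [J]-word for [u]. *)
Lemma gen_pos_eq1 J u : J \subset S -> u \in <<J>> -> lmin J u -> u = 1.
Proof.
move=> JS /gen_word[c cJ ->].
have [k] := ubnP (size c); elim: k c cJ => // k IH [|j c] cJ; first by rewrite big_nil.
rewrite /= ltnS => lek /lminP min.
have jJ : j \in J by apply: cJ; rewrite mem_head.
have c'J : {subset c <= J} by move=> t tc; apply: cJ; rewrite inE tc orbT.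
have jS := subsetP JS _ jJ.
have cW : \prod_(t <- c) t \in W by apply: (gen_W JS); apply: word_gen.
have := min _ jJ; rewrite big_cons act_alpha_mul // posN; last exact: root_actW.
move=> n; have [|c' [c'J' sz]] :=
    exchange JS c'J (group1 W) jS (pos_alpha jS) _ n.
  by left; rewrite (ga_act1 ga).
rewrite conjg1 => e; rewrite -e; apply: IH => //.
  by apply: leq_trans lek; rewrite -sz.
by apply/lminP => t tJ; rewrite e; have := min _ tJ; rewrite big_cons.
Qed.

Lemma mem_gen_simple J s : J \subset S -> s \in S -> (s \in <<J>>) = (s \in J).
Proof.
move=> JS sS; apply/idP/idP => [sJ | ]; last exact: mem_gen.
apply: contraT => nsJ; have := cf_gen (alpha s) JS sJ sS nsJ.
rewrite (ga_act_alpha ga) // cfN (ga_cf_alpha ga) // eqxx => /eqP.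
by rewrite eq_sym -subr_eq0 opprK -mulr2n pnatr_eq0.
Qed.

Lemma gen_descent J u :
  J \subset S -> u \in <<J>> -> u != 1 -> exists2 s, s \in J & ~~ pos (alpha s |> u).
Proof.
move=> JS uJ u1; apply/exists_inP; apply: contraR u1 => /exists_inPn h.
by apply/eqP/(gen_pos_eq1 JS uJ)/lminP => s /h; rewrite negbK.
Qed.

(** * Supports of elements and parabolic decompositions *)

(** Strip a right descent [c] off [v]: by induction [s] lies below [s * (v * c)], which is shorter
    than [s * v] and differs from it by a reflection. *)
Lemma bruhat_descent s (v : gT) : s \in S -> v \in W -> pos (alpha s |> v) ->
  bruhat W S s (s * v).
Proof.
move=> sS; have sW := S_W sS; have [k] := ubnP (len S v).
elim: k v => // k IH v lek vW pv.
have [-> | v1] := eqVneq v 1; first by rewrite mulg1; apply: connect0.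
have vV : v^-1 \in <<S>> by rewrite -(ga_gen ga) groupV.
have [|c cS nc] := gen_descent (subxx S) vV; first by rewrite invg_eq1.
have cW := S_W cS.
have lt_vc : (len S (v * c)%g < len S v)%N.
  by rewrite -(len_descent cS) ?groupV // -{1}(simpleV cS) -invMg !lenV ?groupM in nc.
have lt_sv : (len S v < len S (s * v)%g)%N.
  rewrite -{1}(simpleK v sS) len_descent ?groupM // act_alpha_mul // posN ?pv //.
  exact: root_actW.
have svc : ~~ (len S (s * v)%g < len S v)%N by rewrite -leqNgt ltnW.
(* Otherwise [alpha s |> v] is [alpha c], hence [v * c = s * v], although [c] shortens [v] and [s]
   lengthens it. *)
have pvc : pos (alpha s |> (v * c)).
  rewrite (ga_actM ga) //; apply: contraR svc => n.
  have /(ga_simple_conj ga sS cS vW) e : alpha s |> v = alpha c \/ alpha s |> v =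
    (- alpha c)%R.
    by left; apply: pos_simple n => //; apply: root_actW.
  by rewrite -(_ : v * c = s * v) // -e conjgE !mulgA mulgV mul1g.
have := IH (v * c) (leq_trans lt_vc lek) (groupM vW cW) pvc.
move=> /connect_trans; apply; apply: connect1; apply/andP; split.
  rewrite !invMg -!mulgA (mulKg s v) mulVg mulg1 simpleV //.
  by rewrite -[c]conjg1 memJ_class_support ?group1.
exact: leq_ltn_trans (len_mul sS (groupM vW cW)) (leq_ltn_trans lt_vc lt_sv).
Qed.

(** Let [b] be the positive root of the reflection [u^-1 * v]. If [b |> v^-1] is negative, deleting
    a letter from a [J]-word of [v^-1] yields [u^-1]. Otherwise [b |> u^-1] is negative, and
    exchange makes [v] shorter than [u]. *)
Lemma bruhat_step_gen J u (v : gT) : J \subset S -> u \in W -> v \in <<J>> ->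
  bruhat_step W S u v -> u \in <<J>>.
Proof.
move=> JS uW vJ /andP[/imset2P[s g sS gW e] lt].
have vW := gen_W JS vJ; have sW := S_W sS.
have rW : s ^ g \in W by rewrite groupJ.
have eu : u^-1 = s ^ g * v^-1 by rewrite -e mulgK.
have rr : root (alpha s |> g) by apply: root_actW.
have key b : pos b -> b = alpha s |> g \/ b = (- (alpha s |> g))%R -> u \in <<J>>.
  move=> pb eb; have rb : root b by case: eb => ->; last apply: (ga_rootN ga).
  have [nb | pv] := boolP (~~ pos (b |> v^-1)).
    have := vJ; rewrite -groupV => /gen_word[c cJ ec]; rewrite ec in nb.
    have [c' [c'J _ e']] := exchange JS cJ gW sS pb eb nb.
    by rewrite -groupV eu ec -e' word_gen.
  have nb : ~~ pos (b |> u^-1).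
    have bg : b |> s ^ g = (- b)%R.
      have er : alpha s |> g |> s ^ g = (- (alpha s |> g))%R.
        by rewrite -(ga_actM ga) // conjgE mulKVg (act_alpha_mul sS gW).
      by case: eb => ->; rewrite ?actN ?er.
    rewrite eu (ga_actM ga) ?groupV // bg actN ?groupV // posN; last first.
      by apply: (ga_root_act ga); rewrite ?groupV.
    exact: pv.
  have [c [cS ec szc]] := reduced_word (groupVr uW); rewrite ec in nb.
  have [c' [c'S sz' e']] := exchange (subxx S) cS gW sS pb eb nb.
  have : (len S v^-1%g < len S u^-1%g)%N.
    rewrite -szc -sz' ltnS (_ : v^-1 = \prod_(t <- c') t) ?len_word // e' -ec eu.
    by rewrite mulgA -expg2 -conjXg expg2 (ga_simple_sq ga) // conj1g mul1g.
  by rewrite !lenV // ltnNge ltnW.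
have [p | n] := boolP (pos (alpha s |> g)); first by apply: (key _ p); left.
by apply: (key (- (alpha s |> g))%R); [rewrite posN | right].
Qed.

Lemma bruhat_gen J u (v : gT) : J \subset S -> u \in W -> v \in <<J>> ->
  bruhat W S u v -> u \in <<J>>.
Proof.
move=> JS + vJ /connectP[p]; elim: p u => [|x p IH] u /= uW + e.
  by move=> _; rewrite -e.
case/andP=> st pt; have xW : x \in W.
  case/andP: st => /imset2P[s g sS gW e1] _.
  by rewrite -(mulKVg u x) groupM // e1 groupJ // S_W.
by apply: (bruhat_step_gen JS uW _ st); apply: IH.
Qed.

Lemma SuppP s u : s \in S -> (s \in Supp W S u) = bruhat W S s u.
Proof. by move=> sS; rewrite inE sS. Qed.

Lemma Supp_sub u : Supp W S u \subset S.
Proof. by apply/subsetP => s; rewrite inE => /andP[]. Qed.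

(** Peel off a left descent [s]: it lies below [u], and so does everything below [s * u]. *)
Lemma gen_Supp u : u \in W -> u \in <<Supp W S u>>.
Proof.
have [k] := ubnP (len S u); elim: k u => // k IH u lek uW.
have [-> | u1] := eqVneq u 1; first exact: group1.
have uS : u \in <<S>> by rewrite -(ga_gen ga).
have [s sS n] := gen_descent (subxx S) uS u1.
have sW := S_W sS.
have lt : (len S (s * u)%g < len S u)%N by rewrite len_descent.
have suW : s * u \in W by rewrite groupM.
have psu : pos (alpha s |> (s * u)).
  by rewrite act_alpha_mul // posN //; apply: root_actW.
have sSu : s \in Supp W S u.
  by rewrite SuppP //; have := bruhat_descent sS suW psu; rewrite simpleK.
suff su : s * u \in <<Supp W S u>>.
  by have := groupM (mem_gen sSu) su; rewrite simpleK.
have sub : Supp W S (s * u) \subset Supp W S u.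
  apply/subsetP => t; rewrite !inE => /andP[-> /connect_trans]; apply.
  apply: connect1; apply/andP; split=> //.
  by rewrite invMg (simpleV sS) -mulgA -conjgE memJ_class_support.
exact: subsetP (genS sub) _ (IH _ (leq_trans lt lek) suW).
Qed.

(** So [Supp W S u] is the least set of simple reflections generating a subgroup that contains [u];
    from here on this replaces the Bruhat order. *)
Lemma mem_gen_Supp J u : J \subset S -> u \in W ->
  (u \in <<J>>) = (Supp W S u \subset J).
Proof.
move=> JS uW; apply/idP/idP => [uJ | sub];
  last exact: subsetP (genS sub) _ (gen_Supp uW).
apply/subsetP => s; rewrite inE => /andP[sS /(bruhat_gen JS (S_W sS) uJ)].
by rewrite mem_gen_simple.
Qed.

Lemma mem_genI J K u : J \subset S -> K \subset S ->
  u \in <<J>> -> u \in <<K>> -> u \in <<J :&: K>>.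
Proof.
move=> JS KS uJ uK; have uW := gen_W JS uJ.
by rewrite mem_gen_Supp ?subIset ?JS // subsetI -!mem_gen_Supp // uJ.
Qed.

Lemma min_part_spec J w : J \subset S -> w \in W ->
  [/\ min_part W S J w \in W, par_part W S J w \in <<J>>
    & rmin J (min_part W S J w)].
Proof.
move=> JS wW; rewrite /par_part /min_part.
have rm (v : gT) : v \in min_reps W S J -> v \in W /\ rmin J v.
  rewrite inE => /andP[vW /forall_inP mv]; split=> //; apply/rminP => j jJ.
  have jS := subsetP JS _ jJ; have jW := S_W jS.
  apply: contraT; rewrite -len_descent ?groupV // -{1}(simpleV jS) -invMg !lenV
    ?groupM //.
  by rewrite ltnNge mv // mem_lcoset mulKg mem_gen.
case: pickP => [v /andP[/rm[vW rv] vJ] | none]; first by split.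
(* The default of [min_part] never occurs: an element of least length in the coset is a minimal
   representative. *)
have w0 : w \in w *: <<J>> by rewrite lcoset_refl.
case: (@arg_minnP _ w [in w *: <<J>>] (len S) w0) => v.
move=> vJ0 vmin; have vJ : v \in w *: <<J>> by exact: vJ0.
have vW : v \in W.
  by move: vJ; rewrite mem_lcoset => /(gen_W JS); rewrite groupMl ?groupV.
have /negP[] := negbT (none v); apply/andP; split; last first.
  by move: vJ; rewrite mem_lcoset -groupV invMg invgK.
rewrite inE vW; apply/forall_inP => u.
by rewrite (lcoset_eqP vJ) => /vmin.
Qed.

(** * Signs of the roots supported on a set of simple reflections *)

Definition ldes P g := [forall s in P, ~~ pos (alpha s |> g)].

Lemma ldesP P g : reflect {in P, forall s, ~~ pos (alpha s |> g)} (ldes P g).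
Proof. exact: forall_inP. Qed.

Lemma rootW g v : g \in W -> root v -> root (v |> g).
Proof. by move=> gW; apply: (ga_root_act ga). Qed.

Lemma act_expand P g v : P \subset S -> g \in W -> supported P v ->
  v |> g = (\sum_(s in P) cf v s *: (alpha s |> g))%R.
Proof.
move=> PS gW sup; rewrite {1}(supported_expand PS sup) -big_enum act_sum //.
by rewrite big_enum; apply: eq_bigr => s _; rewrite actZ.
Qed.

Lemma cf_act_expand P g v t : P \subset S -> g \in W -> supported P v ->
  cf (v |> g) t = (\sum_(s in P) cf v s * cf (alpha s |> g) t)%R.
Proof.
move=> PS gW sup; rewrite (act_expand PS gW sup) -big_enum cf_sum big_enum.
by apply: eq_bigr => s _; rewrite cfZ.
Qed.

(** Nonnegative combinations of simple roots of [P] go to nonnegative combinations of positive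
    roots; a negative [v] is treated through its opposite. *)
Lemma lmin_pos P g v : P \subset S -> g \in W -> root v -> supported P v ->
  lmin P g -> pos (v |> g) = pos v.
Proof.
move=> PS gW + + /lminP min.
have half b : supported P b -> pos b -> pos (b |> g).
  move=> sb /posP pb; apply/posP => t tS; rewrite (cf_act_expand _ PS) //.
  apply: sumr_ge0 => s sP; rewrite mulr_ge0 ?pb ?(subsetP PS) //.
  exact: (posP _ (min _ sP)).
move=> rv sv; apply/idP/idP; last exact: half.
apply: contraLR; rewrite -!posN //; last exact: rootW.
by rewrite -actN //; apply: half; rewrite supportedN.
Qed.

(** The simple roots of [P] all become negative, so a combination of them with coefficients of one
    sign is reversed. *)
Lemma ldes_pos P g v : P \subset S -> g \in W -> root v -> supported P v ->
  ldes P g -> pos (v |> g) = ~~ pos v.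
Proof.
move=> PS gW + + /ldesP des.
have half b : root b -> supported P b -> pos b -> ~~ pos (b |> g).
  move=> rb sb /posP pb; rewrite -posN; last exact: rootW.
  apply/posP => t tS; rewrite cfN (cf_act_expand _ PS) // -sumrN.
  apply: sumr_ge0 => s sP; have sS := subsetP PS _ sP.
  have := des _ sP; rewrite -posN; last exact: root_actW.
  by move/posP/(_ t tS); rewrite cfN => nn; rewrite -mulrN mulr_ge0 ?pb.
move=> rv sv; have [pv | nv] := boolP (pos v); first exact: negbTE (half _ rv sv pv).
have rvg : root (v |> g) by apply: rootW.
rewrite -[pos _]negbK -posN // -actN //; apply: half; rewrite ?supportedN ?posN //.
exact: (ga_rootN ga).
Qed.

Lemma cf_root_neq0 v : root v -> exists2 s, s \in S & cf v s != 0%R.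
Proof.
move=> rv; apply/exists_inP; apply: contraT => /exists_inPn h.
case: (ga_root0 ga); rewrite -(_ : v = 0%R) //.
by apply: (ga_cf_eq0 ga) => s /h; rewrite negbK => /eqP.
Qed.

Lemma pos_cf_gt0 J v : root v -> pos v -> supported J v ->
  exists t, [/\ t \in S, t \in J & (0 < cf v t)%R].
Proof.
move=> rv /posP pv /supportedP sup; have [t tS nz] := cf_root_neq0 rv.
exists t; split; rewrite ?lt_neqAle 1?eq_sym ?nz ?pv //.
by apply: contraR nz => tJ; rewrite sup.
Qed.

(* A simple root cannot be a sum of two positive multiples of positive roots, so
   only one of the roots [alpha i |> d^-1] can occur in [alpha c]. *)
Lemma rmin_simple I d c : I \subset S -> d \in W -> c \in S -> rmin I d ->
    supported I (alpha c |> d) -> pos (alpha c |> d) ->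
  exists2 i, i \in I & alpha c |> d = alpha i.
Proof.
move=> IS dW cS /rminP min sup pv; set v := alpha c |> d in sup pv *.
have rv : root v by apply: root_actW.
have [i [iS iI gt0]] := pos_cf_gt0 rv pv sup.
have dVW : d^-1 \in W by rewrite groupV.
have ev : v |> d^-1 = alpha c by rewrite actK.
exists i => //; rewrite -[RHS](actKV _ dW); congr (_ |> d).
have ri : root (alpha i |> d^-1) by apply: root_actW.
case: (ga_root_multiple ga ri cS) => // [t tS tc | e]; last first.
  by have := min _ iI; rewrite e (negPf (neg_alphaN cS)).
have : cf (v |> d^-1) t = 0%R.
  by rewrite ev (ga_cf_alpha ga) // eq_sym (negPf tc).
rewrite (cf_act_expand _ IS) // => /psumr_eq0P h.
have /eqP : (cf v i * cf (alpha i |> d^-1) t = 0)%R.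
  apply: h => // s sI; have sS := subsetP IS _ sI.
  by rewrite mulr_ge0 ?(posP _ pv) // (posP _ (min _ sI)).
by rewrite mulf_eq0 gt_eqF //= => /eqP.
Qed.

Lemma simple_conj_pos s t g : s \in S -> t \in S -> g \in W ->
  s ^ g = t -> pos (alpha s |> g) -> alpha s |> g = alpha t.
Proof.
move=> sS tS gW /(ga_simple_conj ga sS tS gW)[-> // | ->].
by rewrite (negPf (neg_alphaN tS)).
Qed.

(** * Factorizations along parabolic subgroups and double cosets *)

Lemma factor_lmin T g : T \subset S -> g \in W ->
  exists a f, [/\ a \in <<T>>, f \in W, lmin T f & g = a * f].
Proof.
move=> TS gW; have [vW] := min_part_spec TS (groupVr gW).
set v := min_part _ _ _ _ in vW *; rewrite /par_part -/v => uT min.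
exists (v^-1 * g^-1)^-1, v^-1; rewrite ?groupV; split=> //.
by rewrite invMg !invgK mulgK.
Qed.

(** The quotient [a'^-1 * a] carries [f] to [f']. Since [f] keeps the signs of roots supported on
    [T], minimality of [f'] leaves the quotient no left descent in [T], so it is trivial. *)
Lemma lmin_uniq T a f a' f' : T \subset S -> a \in <<T>> -> a' \in <<T>> ->
  f \in W -> lmin T f -> lmin T f' -> a * f = a' * f' -> a = a'.
Proof.
move=> TS aT a'T fW minf /lminP minf' e.
have sT : a'^-1 * a \in <<T>> by rewrite groupM ?groupV.
have ef' : f' = a'^-1 * a * f by rewrite -mulgA e mulKg.
apply/eqP; rewrite eq_sym eq_mulgV1 -eq_invg1; apply/eqP.
suff : a'^-1 * a = 1.
  by move=> e1; rewrite invMg invgK -(mulKVg a' a) e1 mulg1 mulgV.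
apply: (gen_pos_eq1 TS sT); apply/lminP => r rT; have rS := subsetP TS _ rT.
have sW := gen_W TS sT.
have := minf' _ rT; rewrite ef' (ga_actM ga) // (lmin_pos TS) //.
  exact: root_actW.
by rewrite supported_gen // supported_alpha.
Qed.

(* If [d] is minimal in [W_T d W_I], then [W_T] meets [d W_I d^-1] in a standard
   parabolic subgroup, through which the [W_T]-part of [d u] is obtained. *)
Lemma double_coset_factor T I d u : T \subset S -> I \subset S -> d \in W ->
    lmin T d -> rmin I d -> u \in <<I>> ->
  exists a f, [/\ a \in <<[set c in T | c ^ d \in I]>>, f \in W, lmin T f
                & d * u = a * f].
Proof.
move=> TS IS dW mind rmind; have [k] := ubnP (len S u).
elim: k u => // k IH u lek uI; have uW := gen_W IS uI.
have [/lminP min | /forall_inPn[c cT n]] := boolP (lmin T (d * u)).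
  by exists 1, (d * u); rewrite group1 groupM ?mul1g //; split=> //; apply/lminP.
have cS := subsetP TS _ cT; have cW := S_W cS.
have rcd : root (alpha c |> d) by apply: root_actW.
have pcd : pos (alpha c |> d) by apply: (lminP _ _ mind).
rewrite (ga_actM ga) // in n.
(* The positive root [alpha c |> d] is made negative by [u], so it is supported on [I] and then
   simple, which means [c * d = d * i]. The induction replaces [u] by the shorter [i * u] and puts
   [c] in front of [a]. *)
have sup : supported I (alpha c |> d).
  by apply: contraR n => nsup; rewrite (pos_gen IS).
have [i iI ei] := rmin_simple IS dW cS rmind sup pcd.
have iS := subsetP IS _ iI.
have cdi : c ^ d = i by apply/(ga_simple_conj ga cS iS dW); left.
have [||a [f [aC fW minf e]]] := IH (i * u).
- by apply: (leq_trans _ (lek : (len S u <= k)%N)); rewrite len_descent // -ei.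
- by rewrite groupM // mem_gen.
exists (c * a), f; split=> //; first by rewrite groupM // mem_gen // inE cT cdi.
by rewrite -mulgA -e -cdi (mulgA d) -conjgC -mulgA simpleK.
Qed.

(** * Commuting simple reflections *)

(* For simple reflections: [c] and [s] are distinct and commute. *)
Definition fixes c s := alpha s |> c == alpha s.

Lemma fixes_neq c s : s \in S -> fixes c s -> c != s.
Proof.
move=> sS; apply: contraL => /eqP ->; rewrite /fixes (ga_act_alpha ga) //.
by apply: contraL (pos_alpha sS) => /eqP <-; apply: neg_alphaN.
Qed.

Lemma fixes_comm c s : c \in S -> s \in S -> fixes c s -> commute c s.
Proof.
move=> cS sS /eqP e; have cW := S_W cS.
have e' : s ^ c = s.
  by apply/(ga_simple_conj ga sS sS cW); left.
by rewrite /commute [RHS]conjgC e'.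
Qed.

(** Commutation gives [alpha c |> s] as [alpha c] up to sign; the minus sign is excluded because [s]
    leaves the coefficient at [c] alone. *)
Lemma fixesC c s : c \in S -> s \in S -> fixes c s -> fixes s c.
Proof.
move=> cS sS f; have cs := fixes_neq sS f; have sW := S_W sS.
rewrite /fixes; have /(ga_simple_conj ga cS cS sW)[-> // | e] : c ^ s = c.
  by rewrite conjgE (fixes_comm cS sS f) mulKg.
have := ga_cf_act ga (alpha c) sS cS cs.
by rewrite e cfN (ga_cf_alpha ga) // eqxx => /eqP;
  rewrite eq_sym -subr_eq0 opprK -mulr2n pnatr_eq0.
Qed.

Lemma gen_commute M N m n : M \subset S -> N \subset S ->
  {in M & N, forall m' n', fixes n' m'} -> m \in <<M>> -> n \in <<N>> -> commute m n.
Proof.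
move=> MS NS fx mM nN; have /centsP : <<M>> \subset 'C(<<N>>); last by apply.
rewrite cent_gen gen_subG; apply/centsP => m' m'M n' n'N; apply/commute_sym.
by apply: fixes_comm; rewrite ?(subsetP MS _ m'M) ?(subsetP NS _ n'N) // fx.
Qed.

Lemma fix_supported A X x v : A \subset S -> X \subset S ->
  {in A & X, forall a c, fixes c a} -> supported A v -> x \in <<X>> -> v |> x = v.
Proof.
move=> AS XS fx sup xX; have xW := gen_W XS xX.
rewrite (act_expand AS xW sup) {2}(supported_expand AS sup).
apply: eq_bigr => a aA; congr (_ *: _)%R.
case/gen_word: xX => c cX ->; elim: c cX => [|r c IH] cX.
  by rewrite big_nil (ga_act1 ga).
have rX : r \in X by apply: cX; rewrite mem_head.
have c'X : {subset c <= X} by move=> t tc; apply: cX; rewrite inE tc orbT.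
have rW := S_W (subsetP XS _ rX).
rewrite big_cons (ga_actM ga) // ?(eqP (fx _ _ aA rX)) ?IH //.
by apply: (gen_W XS); apply: word_gen.
Qed.

(* Along a reduced word of [x] the image of [alpha s] only gains positive multiples
   of roots of [X]; if it returns to [alpha s], no letter has moved it. *)
Lemma gen_fixes X s x : X \subset S -> s \in S -> s \notin X -> x \in <<X>> ->
  alpha s |> x = alpha s -> x \in <<[set c in X | fixes c s]>>.
Proof.
move=> XS sS sX; have [k] := ubnP (len S x).
elim: k x => // k IH x lek xX ex; have xW := gen_W XS xX.
have [-> | x1] := eqVneq x 1; first exact: group1.
have [c cX nc] := gen_descent XS xX x1.
have cS := subsetP XS _ cX; have cW := S_W cS.
have x'X : c * x \in <<X>> by rewrite groupM // mem_gen.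
have x'W := gen_W XS x'X.
have rc : root (alpha c |> (c * x)) by apply: root_actW.
have pc : pos (alpha c |> (c * x)).
  by rewrite act_alpha_mul // posN //; apply: root_actW.
have supc : supported X (alpha c |> (c * x)).
  by rewrite supported_gen // supported_alpha.
have [t [tS tX tgt]] := pos_cf_gt0 rc pc supc.
have ts : t != s by apply: contraNneq sX => <-.
have sc : s != c by apply: contraNneq sX => ->.
set b := alpha s |> c.
have eb : b = (alpha s + cf b c *: alpha c)%R.
  apply: cf_inj => r rS; rewrite cfD cfZ !(ga_cf_alpha ga) //.
  have [<- | rc'] := eqVneq c r; first by rewrite (negPf sc) add0r mulr1.
  have rc1 : r != c by rewrite eq_sym.
  by rewrite mulr0 addr0 (ga_cf_act ga _ cS rS rc1) (ga_cf_alpha ga).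
have pb : pos b by apply: (pos_alpha_gen XS); rewrite ?mem_gen.
have p1 : pos (alpha s |> (c * x)) by apply: (pos_alpha_gen XS).
(* The image of [b = alpha s + k *: alpha c] is [alpha s], whose coefficient at [t] is zero. Both
   summands contribute nonnegatively there and the image of [alpha c] has a positive coefficient, so
   [k = 0]. *)
have : cf (b |> (c * x)) t = 0%R.
  by rewrite -(ga_actM ga) // simpleK // ex (ga_cf_alpha ga) // eq_sym (negPf ts).
rewrite eb actD // actZ // cfD cfZ => /eqP; rewrite paddr_eq0 ?(posP _ p1) //;
  last first.
  by rewrite mulr_ge0 ?(posP _ pb) // (posP _ pc).
case/andP=> _; rewrite mulf_eq0 (gt_eqF tgt) orbF => /eqP k0.
have fc : alpha s |> c = alpha s by rewrite -/b eb k0 scale0r addr0.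
have -> : x = c * (c * x) by rewrite simpleK.
rewrite groupM //; first by rewrite mem_gen // inE cX /fixes fc eqxx.
apply: IH => //; first by apply: (leq_trans _ (lek : (len S x <= k)%N));
  rewrite len_descent.
by rewrite (ga_actM ga) // fc.
Qed.

(** The coefficient at [s], outside [X], survives [x]; this forces [r = s] and the plus sign in
    [alpha r |> x]. Then [gen_fixes] applies. *)
Lemma conj_fixes X r s x : X \subset S -> r \in S -> s \in S -> s \notin X ->
  x \in <<X>> -> r ^ x = s -> r = s /\ {in Supp W S x, forall c, fixes c s}.
Proof.
move=> XS rS sS sX xX; have xW := gen_W XS xX.
move/(ga_simple_conj ga rS sS xW) => e.
have ers : r = s.
  apply/eqP; apply: contraT => ne; have := cf_gen (alpha r) XS xX sS sX.
  rewrite (ga_cf_alpha ga) // (negPf ne).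
  by case: e => ->; rewrite ?cfN (ga_cf_alpha ga) // eqxx => /eqP;
    rewrite ?oppr_eq0 oner_eq0.
rewrite {r rS}ers in e *; split=> // c.
have ex : alpha s |> x = alpha s.
  case: e => // e; have := cf_gen (alpha s) XS xX sS sX.
  by rewrite e cfN (ga_cf_alpha ga) // eqxx => /eqP;
    rewrite eq_sym -subr_eq0 opprK -mulr2n pnatr_eq0.
have := gen_fixes XS sS sX xX ex; rewrite mem_gen_Supp //; last first.
  by apply: subset_trans XS; apply/subsetP => t; rewrite inE => /andP[].
by move/subsetP => h /h; rewrite inE => /andP[].
Qed.

(** Let [X] be the support of [o * a] and factor [(o * a)^-1] along [U :&: X]. Letters outside [X]
    are no left descents of elements of [<<X>>], so this is also the factorization along [U], and
    [a^-1] and [o^-1] lie in [<<X>>]. *)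
Lemma Supp_mul U o a : U \subset S -> o \in W -> rmin U o -> a \in <<U>> ->
  Supp W S o \subset Supp W S (o * a) /\ Supp W S a \subset Supp W S (o * a).
Proof.
move=> US oW mino aU; have aW := gen_W US aU.
have gW : o * a \in W by rewrite groupM.
set X := Supp W S (o * a); have XS : X \subset S := Supp_sub _.
have gX : (o * a)^-1 \in <<X>> by rewrite groupV gen_Supp.
have UXS : U :&: X \subset S by rewrite subIset ?US.
have [b [f [bUX fW minf e]]] := factor_lmin UXS (groupVr gW).
have bX : b \in <<X>> by apply: subsetP bUX; rewrite genS ?subsetIr.
have bU : b \in <<U>> by apply: subsetP bUX; rewrite genS ?subsetIl.
have fX : f \in <<X>> by rewrite -(mulKg b f) -e groupM ?gX ?groupV.
have minfU : lmin U f.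
  apply/lminP => k kU; have kS := subsetP US _ kU.
  have [kX | kX] := boolP (k \in X); first by apply: (lminP _ _ minf); rewrite inE kU.
  exact: (pos_alpha_gen XS).
have eab : a^-1 = b.
  by apply: (lmin_uniq US _ bU _ mino minfU (etrans (esym (invMg o a)) e));
    rewrite groupV.
have eof : o^-1 = f by apply: (mulgI b); rewrite -e invMg eab.
by split; rewrite -mem_gen_Supp // -groupV ?eab ?eof.
Qed.

(** Write [z = m * n] with commuting factors. As [m] fixes the roots supported on [N], minimality of
    [z] leaves [n^-1] no left descent in [N], so [n = 1]. *)
Lemma gen_remove_commuting M N z : M \subset S -> N \subset S ->
    {in N & M, forall n m, fixes m n} -> z \in <<M :|: N>> -> rmin N z ->
  z \in <<M>>.
Proof.
move=> MS NS fx; have fx' : {in M & N, forall m n, fixes n m}.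
  by move=> m n mM nN; apply: fixesC (fx _ _ nN mM);
     [apply: subsetP MS _ mM | apply: subsetP NS _ nN].
have cMN : <<N>> \subset 'C(<<M>>).
  by apply/centsP => n nN m mM; apply/commute_sym/(gen_commute MS NS fx').
rewrite -[<<_>>]/(M <*> N) -joing_idl -joing_idr cent_joinEr //.
case/mulsgP=> m n mM nN -> /rminP min.
suff n1 : n^-1 = 1 by rewrite -[n]invgK n1 invg1 mulg1.
apply: (gen_pos_eq1 NS); rewrite ?groupV //; apply/lminP => t tN.
have nW := gen_W NS nN; have mW := gen_W MS mM; have tS := subsetP NS _ tN.
have := min _ tN; rewrite invMg (ga_actM ga) ?groupV //.
rewrite (@fix_supported N M) ?groupV //.
by rewrite supported_gen ?groupV // supported_alpha.
Qed.

Lemma SuppS J x : J \subset S -> x \in <<J>> -> Supp W S x \subset J.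
Proof. by move=> JS xJ; rewrite -mem_gen_Supp // (gen_W JS). Qed.

Lemma sub_lmin A J g : A \subset J -> lmin J g -> lmin A g.
Proof. by move=> /subsetP AJ /lminP m; apply/lminP => s /AJ; apply: m. Qed.

Lemma sub_ldes A J g : A \subset J -> ldes J g -> ldes A g.
Proof. by move=> /subsetP AJ /ldesP m; apply/ldesP => s /AJ; apply: m. Qed.

(** On roots supported on [J], [a^-1] keeps signs, so [x] and [a * x] have the same right descents
    in [I]. *)
Lemma rmin_factor I J a x : I \subset J -> J \subset S -> a \in W -> rmin J a ->
  x \in <<J>> -> rmin I (a * x) -> rmin I x.
Proof.
move=> IJ JS aW mina xJ /rminP min; apply/rminP => i iI.
have iJ := subsetP IJ _ iI; have iS := subsetP JS _ iJ.
have xW := gen_W JS xJ; have := min _ iI.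
rewrite invMg (ga_actM ga) ?groupV // (lmin_pos JS) ?groupV //.
  by apply: root_actW; rewrite ?groupV.
by rewrite supported_gen ?groupV // supported_alpha.
Qed.

(** * Billey-Postnikov decompositions *)

(* [x2] is minimal in the double coset [W_P x2 W_K], so the factor [y] of [a x]
   comes from [W_P] through conjugation by [x2]. *)
Lemma bp_double_coset J K P a x b y : J \subset S -> K \subset S -> P \subset S ->
    a \in <<P>> -> rmin J a -> x \in <<J>> -> rmin (J :&: K) (a * x) ->
    b \in W -> rmin K b -> y \in <<K>> -> b * y = a * x ->
  exists x1 x2,
    [/\ x = x1 * x2, x1 \in <<Supp W S x :&: P>>, x2 \in <<Supp W S x>>,
        lmin P x2 & y \in <<[set c in K | c ^ x2^-1 \in P]>>] /\ rmin K x2.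
Proof.
move=> JS KS PS aP mina xJ minz bW minb yK e; set A := Supp W S x.
have AS : A \subset S := Supp_sub x.
have xW := gen_W JS xJ; have xA : x \in <<A>> by apply: gen_Supp.
have APS : A :&: P \subset S by rewrite subIset ?AS.
have [x1 [x2 [x1A x2W minx2 ex]]] := factor_lmin APS xW.
have x1P : x1 \in <<P>> by apply: gen_subset x1A; rewrite subsetIr.
have x2A : x2 \in <<A>>.
  rewrite -(mulKg x1 x2) -ex groupM ?groupV //.
  by apply: gen_subset x1A; rewrite subsetIl.
have x2J : x2 \in <<J>> by apply: gen_subset x2A; apply: SuppS.
have minP2 : lmin P x2.
  apply/lminP => r rP; have rS := subsetP PS _ rP.
  have [rA | rA] := boolP (r \in A); last exact: pos_alpha_gen x2A.
  by apply: (lminP _ _ minx2); rewrite inE rA.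
have pP : a * x1 \in <<P>> by rewrite groupM.
have pW := gen_W PS pP.
have ez : a * x = a * x1 * x2 by rewrite ex mulgA.
have minK2 : rmin K x2.
  apply/rminP => k kK; have kS := subsetP KS _ kK.
  have [kJ | kJ] := boolP (k \in J); last first.
    by apply: (pos_alpha_gen JS); rewrite ?groupV.
  have rk : root (alpha k |> x2^-1) by apply: root_actW; rewrite ?groupV.
  (* Suppose that [be], the opposite of [alpha k |> x2^-1], is positive. If supported on [P], it
     stays positive under [x2], but its image is the opposite of [alpha k]. If not, [(a * x1)^-1]
     keeps it positive, against the minimality of [a * x]. *)
  apply: contraT; rewrite -posN // => pk; set be := (- _)%R in pk.
  have rbe : root be by apply: (ga_rootN ga).
  have [sup | nsup] := boolP (supported P be).
    have := lmin_pos PS x2W rbe sup minP2.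
    by rewrite pk /be actN // actKV // (negPf (neg_alphaN kS)).
  have kI : k \in J :&: K by rewrite inE kJ.
  have := rminP _ _ minz _ kI.
  rewrite ez invMg (ga_actM ga) ?groupV // => pz.
  have := @pos_gen P (a * x1)^-1 be PS; rewrite groupV => /(_ pP rbe nsup).
  rewrite pk /be actN ?groupV // posN ?pz //.
  by apply: rootW; rewrite ?groupV.
exists x1, x2; split=> //; split=> //.
have min' : rmin P x2^-1 by rewrite /rmin invgK.
have [|t [f [tC fW minf et]]] :=
    double_coset_factor KS PS (groupVr x2W) minK2 min' (_ : (a * x1)^-1 \in <<P>>).
  by rewrite groupV.
have tK : t \in <<K>>.
  by apply: gen_subset tC; apply/subsetP => c; rewrite inE => /andP[].
have : y^-1 * b^-1 = t * f by rewrite -et -!invMg -ez e.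
by move/(lmin_uniq KS _ tK _ minb minf) => ey; rewrite -groupV ey ?groupV.
Qed.

(** The root [v |> x1^-1] is supported on [P :&: J], and [x1 * x2 * h], which reverses such roots,
    sends it to [v |> x2 |> h]. *)
Lemma bp_descent J P x1 x2 h v : P \subset S -> x1 \in <<P :&: J>> ->
    x2 \in W -> h \in W -> ldes (P :&: J) (x1 * x2 * h) -> root v ->
    supported (P :&: J) v -> pos (v |> x2 |> h) -> ~~ pos (v |> x1^-1).
Proof.
move=> PS x1P x2W hW des rv sup pv; have PJS : P :&: J \subset S by rewrite subIset ?PS.
have x1W := gen_W PJS x1P.
have gW : x1 * x2 * h \in W by rewrite !groupM.
have rg : root (v |> x1^-1) by apply: rootW; rewrite ?groupV.
have sg : supported (P :&: J) (v |> x1^-1) by rewrite supported_gen ?groupV.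
have := ldes_pos PJS gW rg sg des.
by rewrite -mulgA (ga_actM ga) ?groupM // actKV // (ga_actM ga) // pv => <-.
Qed.

(** The conjugate [c = s ^ x2^-1] lies in [P :&: J], and [alpha c |> x2 = alpha s]. If
    [alpha s |> h] were positive, [alpha c |> x1^-1] would be negative, making [s] a right descent
    of [a * x] in [J :&: K]. *)
Lemma bp_restrict J K P a x b y h s :
    J \subset S -> K \subset S -> P \subset S ->
    a \in <<P>> -> rmin J a -> x \in <<J>> -> rmin (J :&: K) (a * x) ->
    b \in W -> rmin K b -> y \in <<K>> -> b * y = a * x ->
    h \in W -> ldes (P :&: J) (x * h) -> s \in Supp W S y -> s \in J ->
  ~~ pos (alpha s |> h).
Proof.
move=> JS KS PS aP mina xJ minz bW minb yK e hW des sy sJ.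
have [x1 [x2 [[ex x1A x2A minx2 yC] _]]] :=
  bp_double_coset JS KS PS aP mina xJ minz bW minb yK e.
have AJ := SuppS JS xJ.
have x1P : x1 \in <<P :&: J>> by apply: gen_subset x1A; rewrite setIC setIS.
have x2J := gen_subset AJ x2A.
have x1J : x1 \in <<J>> by apply: gen_subset x1P; rewrite subsetIr.
have x1W := gen_W JS x1J; have x2W := gen_W JS x2J.
have sS := subsetP JS _ sJ; have aW := gen_W PS aP.
have CS : [set c in K | c ^ x2^-1 \in P] \subset S.
  by apply: subset_trans KS; apply/subsetP => c; rewrite inE => /andP[].
have := subsetP (SuppS CS yC) _ sy; rewrite inE => /andP[sK cP].
set c := s ^ _ in cP; have cS := subsetP PS _ cP.
have ec : c ^ x2 = s by rewrite /c conjgKV.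
have cJ : c \in J by rewrite -(mem_gen_simple JS) // groupJ ?groupV // mem_gen.
have eac : alpha c |> x2 = alpha s.
  by apply: simple_conj_pos => //; apply: (lminP _ _ minx2).
apply: contraT => /negPn ph.
have sup : supported (P :&: J) (alpha c) by rewrite supported_alpha // inE cP.
have rc := ga_root_alpha ga cS.
rewrite ex in des.
have n := bp_descent PS x1P x2W hW des rc sup; rewrite eac in n.
have sI : s \in J :&: K by rewrite inE sJ.
have := rminP _ _ minz _ sI; rewrite ex mulgA !invMg !(ga_actM ga) ?groupM ?groupV //.
rewrite -eac actK // (lmin_pos JS) ?groupV //.
- by rewrite (negPf (n ph)).
- by apply: root_actW; rewrite ?groupV.
- by rewrite supported_gen ?groupV // supported_alpha.
Qed.

(** As [s] is no letter of [x], the root [alpha s |> x] is positive with coefficient 1 at [s]. Since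
    [h] makes it negative, it is supported on [I]; minimality of [x] then makes it simple, so it is
    [alpha s]. *)
Lemma bp_outside I J x h s : I \subset J -> J \subset S -> x \in <<J>> ->
    rmin I x -> h \in <<I>> -> s \in J -> s \notin Supp W S x ->
    ~~ pos (alpha s |> (x * h)) ->
  [/\ s \in I, {in Supp W S x, forall c, fixes c s} & ~~ pos (alpha s |> h)].
Proof.
move=> IJ JS xJ minx hI sJ sx; have IS := subset_trans IJ JS.
have sS := subsetP JS _ sJ; have xW := gen_W JS xJ; have hW := gen_W IS hI.
have xA := gen_Supp xW; have AS := Supp_sub x.
have px : pos (alpha s |> x) by apply: pos_alpha_gen xA.
have rx : root (alpha s |> x) by apply: root_actW.
rewrite (ga_actM ga) // => n.
have sup : supported I (alpha s |> x).
  by apply: contraR n => ns; rewrite (pos_gen IS).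
have [i iI ei] := rmin_simple IS xW sS minx sup px.
have iS := subsetP IS _ iI.
have eis : i = s.
  have := cf_gen (alpha s) AS xA sS sx; rewrite ei !(ga_cf_alpha ga) // eqxx.
  by case: eqP => // _ /eqP; rewrite eq_sym oner_eq0.
rewrite {i iS}eis in iI ei *; split=> //; last by rewrite -ei.
move=> c cA; have := gen_fixes AS sS sx xA ei.
have FS : [set c in Supp W S x | fixes c s] \subset S.
  by apply: subset_trans AS; apply/subsetP => t; rewrite inE => /andP[].
by move/(SuppS FS)/subsetP/(_ _ cA); rewrite inE => /andP[].
Qed.

Lemma bp_descents_setI J K a u b (v' : gT) z h : J \subset S -> K \subset S ->
    [/\ a \in W, rmin J a, u \in <<J>> & ldes (Supp W S a :&: J) u] ->
    [/\ b \in W, rmin K b, v' \in <<K>> & ldes (Supp W S b :&: K) v'] ->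
    [/\ z \in W, rmin (J :&: K) z & h \in <<J :&: K>>] ->
    a * u = z * h -> b * v' = z * h ->
  ldes (Supp W S z :&: (J :&: K)) h.
Proof.
move=> JS KS [aW mina uJ desu] [bW minb vK desv] [zW minz hI] eu ev.
set x := a^-1 * z; set y := b^-1 * z.
have IS : J :&: K \subset S by rewrite subIset ?JS.
have hW := gen_W IS hI.
have hJ : h \in <<J>> by apply: gen_subset hI; rewrite subsetIl.
have hK : h \in <<K>> by apply: gen_subset hI; rewrite subsetIr.
have exu : u = x * h by rewrite /x -mulgA -eu mulKg.
have eyv : v' = y * h by rewrite /y -mulgA -ev mulKg.
have xJ : x \in <<J>> by rewrite -(mulgK h x) -exu groupM ?groupV.
have yK : y \in <<K>> by rewrite -(mulgK h y) -eyv groupM ?groupV.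
have ex : a * x = z by rewrite mulKVg.
have ey : b * y = z by rewrite mulKVg.
have xW := gen_W JS xJ.
apply/ldesP => s; rewrite !inE => /and3P[/andP[sS sz] sJ sK].
(* A letter of [x] is handled by the decomposition along [K]. A letter of [z] that is none of [x] is
   one of [a], and the decomposition along [J] makes it a left descent of [u = x * h]. *)
have [sx | sx] := boolP (s \in Supp W S x).
  apply: (@bp_restrict K J (Supp W S b) b y a x h s) => //;
    rewrite ?Supp_sub ?gen_Supp //.
  - by rewrite setIC ey.
  - by rewrite ex ey.
  - by rewrite -eyv.
have minx : rmin (J :&: K) x.
  by apply: (rmin_factor (subsetIl J K) JS aW mina xJ); rewrite ex.
have [] // := bp_outside (subsetIl J K) JS xJ minx hI sJ sx.
rewrite -exu; apply: (ldesP _ _ desu); rewrite inE sJ andbT.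
have XS : Supp W S a :|: Supp W S x \subset S by rewrite subUset !Supp_sub.
have : z \in <<Supp W S a :|: Supp W S x>>.
  by rewrite -ex groupM // (gen_subset _ (gen_Supp _)) ?subsetUl ?subsetUr.
have sz' : s \in Supp W S z by rewrite inE sS.
by move/(SuppS XS)/subsetP/(_ _ sz'); rewrite in_setU (negPf sx) orbF.
Qed.

(** * Descents along a union *)

(* The letters of [y] that occur in [x2] lie in [J :&: K] and commute with all the
   other letters of [y], so they could be moved to the right end of [y]. *)
Lemma bp_disjoint J K P x2 y : J \subset S -> K \subset S -> P \subset S ->
    x2 \in <<J>> -> y \in <<[set c in K | c ^ x2^-1 \in P]>> ->
    rmin (J :&: K) y ->
  Supp W S y \subset P /\ {in Supp W S y & Supp W S x2, forall c t, fixes t c}.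
Proof.
move=> JS KS PS x2J yC miny.
have CS : [set c in K | c ^ x2^-1 \in P] \subset S.
  by apply: subset_trans KS; apply/subsetP => c; rewrite inE => /andP[].
have x2W := gen_W JS x2J; have yW := gen_W CS yC.
have BC := subsetP (SuppS CS yC); have BS := Supp_sub y.
set B := Supp W S y in BC BS *; set X2 := Supp W S x2.
have X2S : X2 \subset S := Supp_sub _; have x2X := gen_Supp x2W.
(* The conjugate [c ^ x2^-1] is simple, so by [conj_fixes] it is [c] itself and [c] commutes with
   every letter of [x2]. *)
have out c : c \in B -> c \notin X2 -> c \in P /\ {in X2, forall t, fixes t c}.
  move=> cB cX; have := BC _ cB; rewrite inE => /andP[_ rP].
  have rS := subsetP PS _ rP; have cS := subsetP BS _ cB.
  have [er fx] := conj_fixes X2S rS cS cX x2X (conjgKV x2 c).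
  by rewrite -{1}er.
have MS : B :\: X2 \subset S by rewrite subDset subsetU // BS orbT.
have NS : B :&: X2 \subset S by rewrite subIset ?BS.
have yM : y \in <<B :\: X2>>.
  apply: (gen_remove_commuting MS NS).
  - move=> n m /setIP[nB nX] /setDP[mB mX].
    have [_ fx] := out _ mB mX; apply: fixesC; last exact: fx.
      exact: subsetP X2S _ nX.
    exact: subsetP BS _ mB.
  - by rewrite setUC setID gen_Supp.
  apply: sub_lmin miny; apply/subsetP => c /setIP[cB cX].
  have := BC _ cB; rewrite !inE => /andP[-> _].
  by rewrite (subsetP (SuppS JS x2J)).
(* As [B] is the support of [y], none of its elements is a letter of [x2], and [out] applies to
   all. *)
have sub : B \subset B :\: X2 by apply: SuppS.
split; first by apply/subsetP => c cB; have /setDP[_ /(out _ cB)[]] := subsetP sub _ cB.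
by move=> c t cB tX; have /setDP[_ /(out _ cB)[_]] := subsetP sub _ cB; apply.
Qed.

Lemma supported_gen_fixes A C x v : A \subset S -> C \subset S ->
    {in C & A, forall c a, c \notin A -> fixes c a} ->
    x \in <<C>> -> supported A v -> supported A (v |> x).
Proof.
move=> AS CS fx /gen_word[c cC ->]; elim: c v cC => [|r c IH] v cC sup.
  by rewrite big_nil (ga_act1 ga).
have rC : r \in C by apply: cC; rewrite mem_head.
have c'C : {subset c <= C} by move=> t tc; apply: cC; rewrite inE tc orbT.
have cW : \prod_(t <- c) t \in W by apply: (gen_W CS); apply: word_gen.
have rS := subsetP CS _ rC; have rW := S_W rS.
rewrite big_cons (ga_actM ga) //; apply: IH => //.
have [rA | rA] := boolP (r \in A); first by rewrite supported_gen ?mem_gen.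
have rr : [set r] \subset S by rewrite sub1set.
rewrite (fix_supported AS rr) // ?mem_gen ?set11 // => a r' aA /set1P ->.
exact: fx.
Qed.

(** With [p = a * x1 * y2^-1] one has [a * (x1 * x2) * h = p * t * f]; in the application [p * t] is
    the [<<T>>]-part of [w]. The root [v = alpha r |> t^-1] is supported on [A] and on [T], and
    [v |> (x2 * y2) |> h] is the positive root [alpha r |> f]. *)
Lemma bp_right_descent J I P T C A Y a x1 x2 y2 h t f :
    J \subset S -> I \subset S -> P \subset S -> Y \subset S ->
    A \subset J -> T \subset P -> C \subset T ->
    a \in W -> rmin J a -> x1 \in <<A :&: P>> -> x2 \in <<A>> -> y2 \in <<Y>> ->
    h \in <<I>> -> {in A & Y, forall c s, fixes s c} ->
    {in C & A, forall c s, c \notin A -> fixes c s} ->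
    rmin I (a * (x1 * x2)) -> lmin T (x2 * y2) ->
    ldes (P :&: J) (x1 * x2 * h) -> t \in <<C>> -> f \in W -> lmin T f ->
    x2 * y2 * h = t * f ->
  {in T :&: A, forall r, ~~ pos (alpha r |> (a * x1 * y2^-1 * t)^-1)}.
Proof.
move=> JS IS PS YS AJ TP CT aW mina x1AP x2A y2Y hI fxY fxC minz mind des tC fW minf e.
have AS := subset_trans AJ JS; have TS := subset_trans TP PS.
have CS := subset_trans CT TS.
have x1A : x1 \in <<A>> by apply: gen_subset x1AP; rewrite subsetIl.
have x1P : x1 \in <<P :&: J>> by apply: gen_subset x1AP; rewrite setIC setIS.
have [x1W x2W y2W] := And3 (gen_W AS x1A) (gen_W AS x2A) (gen_W YS y2Y).
have [hW tW] := conj (gen_W IS hI) (gen_W CS tC).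
have cxy : commute x2 y2 := gen_commute AS YS fxY x2A y2Y.
move=> r /setIP[rT rA]; have rS := subsetP TS _ rT.
rewrite invMg (ga_actM ga) ?groupV ?groupM ?groupV //.
set v := alpha r |> t^-1; set p := a * x1 * y2^-1.
have pW : p \in W by rewrite !groupM ?groupV.
have rv : root v by apply: root_actW; rewrite ?groupV.
have supA : supported A v.
  by apply: supported_gen_fixes CS fxC _ _; rewrite ?groupV ?supported_alpha.
have supT : supported T v.
  by rewrite supported_gen ?supported_alpha // groupV (gen_subset CT).
have dW : x2 * y2 \in W by rewrite groupM.
have vdh : v |> (x2 * y2) |> h = alpha r |> f.
  by rewrite -(ga_actM ga v dW hW) e (ga_actM ga) // actKV.
have prf : pos (alpha r |> f) by apply: (lminP _ _ minf).
(* If [v] is positive, [bp_descent] makes [v |> x1^-1] negative; [y2] fixes [v], and [a^-1] keeps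
   signs on [J]. *)
have [pv | nv] := boolP (pos v).
  have sup : supported (P :&: J) v.
    by rewrite supportedI (supportedS TP) ?(supportedS AJ).
  have vx2h : pos (v |> x2 |> h).
    have vy := fix_supported AS YS fxY supA y2Y.
    by rewrite -vdh cxy (ga_actM ga v y2W x2W) vy in prf.
  have n := bp_descent PS x1P x2W hW des rv sup vx2h.
  rewrite /p !invMg invgK !(ga_actM ga) ?groupM ?groupV //.
  rewrite (fix_supported AS YS fxY supA y2Y) (lmin_pos JS) ?groupV //.
    by apply: rootW; rewrite ?groupV.
  by apply: supportedS AJ _; rewrite supported_gen ?groupV.
rewrite -posN; last by apply: rootW; rewrite ?groupV.
(* If [v] is negative, its opposite has a positive image under [x2 * y2]. This image is supported on
   [I], since [h] makes it negative, so the inverse of the minimal [a * (x1 * x2)] keeps it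
   positive. *)
have ez : a * (x1 * x2) = p * (x2 * y2).
  by rewrite /p cxy -!mulgA mulKg.
have -> : p^-1 = x2 * y2 * (a * (x1 * x2))^-1 by rewrite ez [(p * _)^-1]invMg mulKVg.
have zW : a * (x1 * x2) \in W by rewrite !groupM.
have rd : root (- v |> (x2 * y2))%R by apply: rootW => //; apply: (ga_rootN ga).
have pd : pos (- v |> (x2 * y2))%R.
  rewrite (lmin_pos TS) ?posN ?supportedN //; exact: (ga_rootN ga).
rewrite -actN ?groupM ?groupV // (ga_actM ga) ?groupV // (lmin_pos IS) ?groupV //.
apply: contraT => nsup; have := pos_gen IS hI rd nsup.
by rewrite pd !actN // vdh posN ?prf //; apply: root_actW.
Qed.

(** Since [c] commutes with [x], only [y] matters. Either [c] is a letter of [y], or [conj_fixes]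
    gives [c ^ y = c], so that [c] itself is in [I]. *)
Lemma bp_conj_fixes A I c x y : A \subset S -> I \subset S -> c \in S ->
    y \in W -> commute c x -> {in A & Supp W S y, forall a t, fixes t a} ->
    (c \in I -> {in A, forall a, fixes a c}) -> c ^ (x * y) \in I ->
  {in A, forall a, fixes c a}.
Proof.
move=> AS IS cS yW cx fx fI; rewrite conjgM [c ^ x]conjgE cx mulKg => cyI a aA.
have [cY | cY] := boolP (c \in Supp W S y); first exact: fx.
have yVY : y^-1 \in <<Supp W S y>> by rewrite groupV gen_Supp.
have [ec _] := conj_fixes (Supp_sub y) (subsetP IS _ cyI) cS cY yVY (conjgK y c).
have aS := subsetP AS _ aA.
by apply: fixesC => //; apply: fI; rewrite // -ec.
Qed.

(* [P0] and [Q0] may exceed the supports of [a] and [b]: in the application they also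
   contain the support of the minimal representative modulo [W_(J :|: K)]. *)
Lemma bp_descents_setU J K P0 Q0 w a u b (v : gT) z h :
    J \subset S -> K \subset S -> P0 \subset S -> Q0 \subset S ->
    [/\ a \in <<P0>>, rmin J a, u \in <<J>> & ldes (P0 :&: J) u] ->
    [/\ b \in <<Q0>>, rmin K b, v \in <<K>> & ldes (Q0 :&: K) v] ->
    rmin (J :&: K) z -> h \in <<J :&: K>> ->
    w \in <<J :|: K>> -> w = a * u -> w = b * v -> w = z * h ->
  ldes (P0 :&: Q0 :&: (J :|: K)) w.
Proof.
move=> JS KS P0S Q0S [aP0 mina uJ desu] [bQ0 minb vK desv] minz hI wU ewu ewv ewz.
set x := a^-1 * z; set y := b^-1 * z; set I := J :&: K in minz hI *.
have IJ : I \subset J := subsetIl J K; have IK : I \subset K := subsetIr J K.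
have IS := subset_trans IJ JS.
have US : J :|: K \subset S by rewrite subUset JS.
have wW := gen_W US wU; have hW := gen_W IS hI.
have aW := gen_W P0S aP0; have bW := gen_W Q0S bQ0.
have hJ := gen_subset IJ hI; have hK := gen_subset IK hI.
have exu : u = x * h by rewrite /x -mulgA -ewz ewu mulKg.
have eyv : v = y * h by rewrite /y -mulgA -ewz ewv mulKg.
have xJ : x \in <<J>> by rewrite -(mulgK h x) -exu groupM ?groupV.
have yK : y \in <<K>> by rewrite -(mulgK h y) -eyv groupM ?groupV.
have ex : a * x = z by rewrite mulKVg.
have ey : b * y = z by rewrite mulKVg.
have xW := gen_W JS xJ; have yW := gen_W KS yK.
have zU : z \in <<J :|: K>>.
  rewrite -(mulgK h z) -ewz groupM ?groupV //.
  by apply: gen_subset hJ; rewrite subsetUl.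
have zW := gen_W US zU.
have minx : rmin I x by apply: (rmin_factor IJ JS aW mina xJ); rewrite ex.
have miny : rmin I y by apply: (rmin_factor IK KS bW minb yK); rewrite ey.
clearbody x y.
pose A := Supp W S x; pose B := Supp W S y.
have AS : A \subset S := Supp_sub _; have BS : B \subset S := Supp_sub _.
have ABS : A :|: B \subset S by rewrite subUset AS.
have AJ : A \subset J := SuppS JS xJ; have BK : B \subset K := SuppS KS yK.
have xA : x \in <<A>> := gen_Supp xW; have yB : y \in <<B>> := gen_Supp yW.
have outJ t : t \in P0 -> t \in J -> t \notin A ->
    [/\ t \in I, {in A, forall c, fixes c t} & ~~ pos (alpha t |> h)].
  move=> tP tJ tA; apply: (bp_outside IJ JS xJ minx hI tJ tA).
  by rewrite -exu; apply: (ldesP _ _ desu); rewrite inE tP.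
have outK t : t \in Q0 -> t \in K -> t \notin B ->
    [/\ t \in I, {in B, forall c, fixes c t} & ~~ pos (alpha t |> h)].
  move=> tQ tK tB; apply: (bp_outside IK KS yK miny hI tK tB).
  by rewrite -eyv; apply: (ldesP _ _ desv); rewrite inE tQ.
have out t : t \in P0 -> t \in Q0 -> t \in J :|: K -> t \notin A :|: B ->
    [/\ t \in I, {in A :|: B, forall c, fixes c t} & ~~ pos (alpha t |> h)].
  move=> tP tQ tU; rewrite inE negb_or => /andP[tA tB].
  have tI : t \in I.
    by case/setUP: tU => [tJ | tK]; [have [] := outJ t | have [] := outK t].
  have [tJ tK] := setIP tI.
  have [_ fA n] := outJ t tP tJ tA; have [_ fB _] := outK t tQ tK tB.
  by split=> // c /setUP[/fA | /fB].
(* A letter of [z = a * x = b * y] outside [A :|: B] is in [P0] and [Q0], so it lies in [I] and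
   commutes with [A :|: B]; minimality of [z] modulo [I] leaves no such letter. *)
have zAB : Supp W S z \subset A :|: B.
  have sN : Supp W S z :\: (A :|: B) \subset S by rewrite subDset subsetU //
    Supp_sub orbT.
  have outN t : t \in Supp W S z :\: (A :|: B) ->
      t \in I /\ {in A :|: B, forall c, fixes c t}.
    case/setDP=> tz tAB; have tU : t \in J :|: K by apply: subsetP (SuppS US zU) _ tz.
    have tP : t \in P0.
      have XS : P0 :|: A \subset S by rewrite subUset P0S.
      have : z \in <<P0 :|: A>>.
        by rewrite -ex groupM // ?(gen_subset (subsetUl _ _) aP0) // (gen_subset
          (subsetUr _ _) xA).
      move/(SuppS XS)/subsetP/(_ _ tz)/setUP=> [//|tA].
      by rewrite inE tA in tAB.
    have tQ : t \in Q0.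
      have XS : Q0 :|: B \subset S by rewrite subUset Q0S.
      have : z \in <<Q0 :|: B>>.
        by rewrite -ey groupM // ?(gen_subset (subsetUl _ _) bQ0) // (gen_subset
          (subsetUr _ _) yB).
      move/(SuppS XS)/subsetP/(_ _ tz)/setUP=> [//|tB].
      by rewrite inE tB orbT in tAB.
    by have [] := out t tP tQ tU tAB.
  apply: SuppS => //; apply: (gen_remove_commuting ABS sN).
  - by move=> n m /outN[_ fx] /fx.
  - by apply: gen_subset (gen_Supp zW); rewrite -subDset.
  by apply: sub_lmin minz; apply/subsetP => t /outN[].
have zgAB : z \in <<A :|: B>> by apply: gen_subset zAB (gen_Supp zW).
apply/ldesP => s /setIP[/setIP[sP0 sQ0] sU]; have sS := subsetP US _ sU.
(* Outside [A :|: B], [z] fixes [alpha s], so the left descent [s] of [h] is one of [w = z * h]. *)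
have [sAB | sAB] := boolP (s \in A :|: B); last first.
  have [_ fs n] := out s sP0 sQ0 sU sAB.
  have s1S : [set s] \subset S by rewrite sub1set.
  have fz : alpha s |> z = alpha s.
    apply: (fix_supported s1S ABS); rewrite ?supported_alpha ?set11 //.
    by move=> c t /set1P -> /fs.
  by rewrite ewz (ga_actM ga) // fz.
(* Cutting down to [A :|: B] makes each element of [T] below a letter of [x] or [y]. The letters of
   [a] and [b] survive, being letters of [z]. *)
pose P := P0 :&: (A :|: B); pose Q := Q0 :&: (A :|: B).
have PS : P \subset S by rewrite subIset ?P0S.
have QS : Q \subset S by rewrite subIset ?Q0S.
have [za zb] : Supp W S a \subset Supp W S z /\ Supp W S b \subset Supp W S z.
  by rewrite -{1}ex -ey; have [-> _] := Supp_mul JS aW mina xJ;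
    have [-> _] := Supp_mul KS bW minb yK.
have aP : a \in <<P>>.
  by rewrite mem_gen_Supp // subsetI (SuppS P0S) // (subset_trans za).
have bQ : b \in <<Q>>.
  by rewrite mem_gen_Supp // subsetI (SuppS Q0S) // (subset_trans zb).
have sP : s \in P by rewrite inE sP0.
have sQ : s \in Q by rewrite inE sQ0.
have desP : ldes (P :&: J) (x * h).
  by rewrite -exu; apply: sub_ldes desu; rewrite setSI ?subsetIl.
have desQ : ldes (Q :&: K) (y * h).
  by rewrite -eyv; apply: sub_ldes desv; rewrite setSI ?subsetIl.
have minax : rmin (J :&: K) (a * x) by rewrite ex.
have minby : rmin (K :&: J) (b * y) by rewrite ey setIC.
have eyx : b * y = a * x by rewrite ex.
have [x1 [x2 [[ex12 x1A x2A minx2 yC] minKx2]]] :=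
  bp_double_coset JS KS PS aP mina xJ minax bW minb yK eyx.
have [y1 [y2 [[ey12 y1B y2B miny2 xC] minJy2]]] :=
  bp_double_coset KS JS QS bQ minb yK minby aW mina xJ (esym eyx).
rewrite -/A in x1A x2A; rewrite -/B in y1B y2B.
have [BP0 fixBx2] := bp_disjoint JS KS PS (gen_subset AJ x2A) yC miny.
have minx' : rmin (K :&: J) x by rewrite setIC.
have [AQ fixAy2] := bp_disjoint KS JS QS (gen_subset BK y2B) xC minx'.
rewrite -/A in AQ fixAy2; rewrite -/B in BP0 fixBx2.
have [x2W y2W] := conj (gen_W AS x2A) (gen_W BS y2B).
have x1A' : x1 \in <<A>> by apply: gen_subset x1A; rewrite subsetIl.
have y1B' : y1 \in <<B>> by apply: gen_subset y1B; rewrite subsetIl.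
have [x1W y1W] := conj (gen_W AS x1A') (gen_W BS y1B').
pose X2 := Supp W S x2; pose Y2 := Supp W S y2.
have [X2S Y2S] : X2 \subset S /\ Y2 \subset S by split; apply: Supp_sub.
have [x2X y2Y] := conj (gen_Supp x2W) (gen_Supp y2W).
have cxy : commute x2 y2 := gen_commute AS Y2S fixAy2 x2A y2Y.
(* The element [p] lies in [<<P>>] because [B] is inside [P]. It also equals [b * y1 * x2^-1], which
   lies in [<<Q>>] because [A] is inside [Q]. *)
pose T := P :&: Q; pose p := a * x1 * y2^-1.
have [TP TQ] : T \subset P /\ T \subset Q by rewrite subsetIl subsetIr.
have TS := subset_trans TP PS.
have z12 : a * x1 * x2 = b * y1 * y2 by rewrite -!mulgA -ex12 -ey12.
have ep : p = b * y1 * x2^-1.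
  by rewrite /p -(mulgK x2 (a * x1)) z12 -mulgA -invMg -cxy invMg mulgA mulgK.
have pT : p \in <<T>>.
  have BPs := gen_subset BP0; have AQs := gen_subset AQ.
  apply: mem_genI => //; last rewrite ep; rewrite !groupM ?groupV //.
  - by apply: gen_subset x1A; rewrite subsetIr.
  - exact: BPs.
  - by apply: gen_subset y1B; rewrite subsetIr.
  - exact: AQs.
have ez : z = p * (x2 * y2) by rewrite cxy /p mulgA mulgKV -mulgA -ex12 ex.
have dW : x2 * y2 \in W by rewrite groupM.
have TAB r : r \in T -> r \in A :|: B by case/setIP=> /setIP[].
(* On roots supported on [A], [y2] acts trivially and [x2] is minimal for [P]; on [B] the roles are
   exchanged. *)
have mind : lmin T (x2 * y2).
  apply/lminP => r rT; have rS := subsetP TS _ rT; rewrite (ga_actM ga) //.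
  have [rP rQ] := setIP rT.
  case/setUP: (TAB r rT) => [rA | rB].
    rewrite (fix_supported AS Y2S fixAy2 _ y2Y); first exact: (lminP _ _ minx2).
    by rewrite supported_gen // supported_alpha.
  rewrite (fix_supported BS X2S fixBx2 _ x2X) ?supported_alpha //.
  exact: (lminP _ _ miny2).
have [dVx dVy] : x2^-1 \in W /\ y2^-1 \in W by rewrite !groupV.
(* The root [alpha i |> y2^-1] is positive and supported on [K]. If also supported on [J], it stays
   positive under [x2^-1] by minimality; if not, because [x2] is in [<<J>>]. *)
have minId : rmin I (x2 * y2).
  apply/rminP => i iI; have iS := subsetP IS _ iI; have [iJ iK] := setIP iI.
  rewrite invMg (ga_actM ga) //; set v' := alpha i |> y2^-1.
  have rv : root v' by apply: root_actW.
  have pv : pos v' by apply: (rminP _ _ minJy2).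
  have x2J := gen_subset AJ x2A; have y2K := gen_subset BK y2B.
  have [sup | nsup] := boolP (supported J v'); last first.
    by rewrite (pos_gen JS _ rv nsup) ?groupV.
  rewrite (lmin_pos IS) //; last exact: sub_lmin IK minKx2.
  by rewrite supportedI sup supported_gen ?groupV // supported_alpha.
(* This gives [w = p * t * f] with [p * t] in [<<T>>] and [f] minimal in [<<T>> f]; next, all of [T]
   must be right descents of [p * t]. *)
have [t [f [tC fW minf e]]] := double_coset_factor TS IS dW mind minId hI.
pose C := [set c in T | c ^ (x2 * y2) \in I]; rewrite -/C in tC.
have CT : C \subset T by apply/subsetP => c; rewrite inE => /andP[].
have tT := gen_subset CT tC; have tW := gen_W TS tT.
have piT : p * t \in <<T>> by rewrite groupM.
(* Such letters belong to [y] and commute with [x2]. This keeps [alpha r |> t^-1] supported on [A]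
   in [bp_right_descent]. *)
have fxCA : {in C & A, forall c a', c \notin A -> fixes c a'}.
  move=> c a' cC a'A cA; move: cC; rewrite inE => /andP[cT cd].
  have cS := subsetP TS _ cT; have [cP cQ] := setIP cT.
  have cB : c \in B by case/setUP: (TAB c cT) => // cA'; rewrite cA' in cA.
  apply: (bp_conj_fixes AS IS cS y2W _ fixAy2 _ cd) => //.
    by apply: (gen_commute BS X2S fixBx2) x2X; apply: mem_gen.
  move=> cI; have [cJ _] := setIP cI; have cP0 : c \in P0 by case/setIP: cP.
  by have [] := outJ c cP0 cJ cA.
have fxCB : {in C & B, forall c b', c \notin B -> fixes c b'}.
  move=> c b' cC b'B cB; move: cC; rewrite inE cxy => /andP[cT cd].
  have cS := subsetP TS _ cT; have [cP cQ] := setIP cT.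
  have cA : c \in A by case/setUP: (TAB c cT) => // cB'; rewrite cB' in cB.
  apply: (bp_conj_fixes BS IS cS x2W _ fixBx2 _ cd) => //.
    by apply: (gen_commute AS Y2S fixAy2) y2Y; apply: mem_gen.
  move=> cI; have [_ cK] := setIP cI; have cQ0 : c \in Q0 by case/setIP: cQ.
  by have [] := outK c cQ0 cK cB.
have desT : ldes T (p * t)^-1.
  apply/ldesP => r rT; case/setUP: (TAB r rT) => [rA | rB].
    apply: (bp_right_descent JS IS PS Y2S AJ TP CT aW mina x1A x2A y2Y hI fixAy2 fxCA _
                    mind _ tC fW minf e); rewrite -?ex12 ?ex //.
    exact/setIP.
  rewrite ep.
  apply: (bp_right_descent KS IS QS X2S BK TQ CT bW minb y1B y2B x2X hI fixBx2 fxCB _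
                    _ _ tC fW minf _); rewrite -?ey12 ?ey -?cxy //.
  exact/setIP.
have sT : s \in T by rewrite inE sP.
have rs : root (alpha s |> (p * t)) by apply: root_actW => //; apply: gen_W TS piT.
have ss : supported T (alpha s |> (p * t)) by rewrite supported_gen // supported_alpha.
(* Since [f] keeps signs on [T], the sign wanted is that of [alpha s |> (p * t)]; [(p * t)^-1]
   reverses it and returns the positive [alpha s]. *)
rewrite ewz ez -mulgA e mulgA (ga_actM ga) ?(gen_W TS piT) // (lmin_pos TS) //.
apply/negP => ps; have piVW : (p * t)^-1 \in W by rewrite groupV (gen_W TS).
have := ldes_pos TS piVW rs ss desT.
by rewrite actK ?(gen_W TS piT) // pos_alpha // ps.
Qed.

(** * Closure of [BP] under intersection and union *)

Lemma mem_BP J w : w \in W -> (J \in BP W S w) =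
  (J \subset S) && ldes (Supp W S (min_part W S J w) :&: J) (par_part W S J w).
Proof.
move=> wW; rewrite inE; have [JS | //] := boolP (J \subset S).
have [aW uJ _] := min_part_spec JS wW; have uW := gen_W JS uJ.
apply/subsetP/ldesP => h s sX; have sS : s \in S by case/setIP: sX => _ /(subsetP JS).
  by rewrite -len_descent //; have := h s sX; rewrite inE => /andP[].
by rewrite inE sS len_descent // h.
Qed.

Lemma BP_setI J K w : w \in W -> J \in BP W S w -> K \in BP W S w ->
  J :&: K \in BP W S w.
Proof.
move=> wW; rewrite !mem_BP // => /andP[JS desJ] /andP[KS desK].
have IS : J :&: K \subset S by rewrite subIset ?JS.
have [aW uJ mina] := min_part_spec JS wW.
have [bW vK minb] := min_part_spec KS wW.
have [zW hI minz] := min_part_spec IS wW.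
rewrite IS /=; apply: (bp_descents_setI JS KS (And4 aW mina uJ desJ) (And4 bW minb
  vK desK)) => //;
  by rewrite /par_part !mulKVg.
Qed.

(** The minimal parts along [J] and [K] of [g], the [J :|: K] part of [w], are [o^-1 * a] and
    [o^-1 * b]. By [Supp_mul] the supports of [a] and [b] contain theirs and that of [o], so they
    serve as [P0] and [Q0]. *)
Lemma BP_setU J K w : w \in W -> J \in BP W S w -> K \in BP W S w ->
  J :|: K \in BP W S w.
Proof.
move=> wW; rewrite !mem_BP // => /andP[JS desJ] /andP[KS desK].
have IS : J :&: K \subset S by rewrite subIset ?JS.
have US : J :|: K \subset S by rewrite subUset JS.
have [aW uJ mina] := min_part_spec JS wW.
have [bW vK minb] := min_part_spec KS wW.
have [oW gU mino] := min_part_spec US wW.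
rewrite US /=; set o := min_part _ _ (J :|: K) w in oW mino *.
set g := par_part _ _ (J :|: K) w in gU *.
set a := min_part _ _ J w in aW mina desJ; set u := par_part _ _ J w in uJ desJ.
set b := min_part _ _ K w in bW minb desK; set v := par_part _ _ K w in vK desK.
have gW := gen_W US gU; have [zW hI minz] := min_part_spec IS gW.
have eg : g = o^-1 * w by [].
have factor (X : {set gT}) c d : X \subset J :|: K -> c \in W -> rmin X c ->
    d \in <<X>> -> c * d = w ->
    [/\ g = o^-1 * c * d, rmin X (o^-1 * c), o^-1 * c \in <<Supp W S c>>
      & Supp W S o \subset Supp W S c].
  move=> XU cW minc dX e; have dU := gen_subset XU dX.
  have ge : g = o^-1 * c * d by rewrite -mulgA e.
  have cU : o^-1 * c \in <<J :|: K>> by rewrite -(mulgK d (o^-1 * c)) -ge groupM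
    ?groupV.
  have [so sc] := Supp_mul US oW mino cU; rewrite mulKVg in so sc.
  split=> //; first by apply: (rmin_factor XU US oW mino cU); rewrite mulKVg.
  by rewrite mem_gen_Supp ?Supp_sub // (gen_W US).
have [ga' mina' aP soP] := factor J a u (subsetUl _ _) aW mina uJ (mulKVg _ _).
have [gb' minb' bQ soQ] := factor K b v (subsetUr _ _) bW minb vK (mulKVg _ _).
have := bp_descents_setU JS KS (Supp_sub a) (Supp_sub b) (And4 aP mina' uJ desJ)
  (And4 bQ minb' vK desK) minz hI gU ga' gb' (esym (mulKVg _ _)).
by apply: sub_ldes; rewrite setSI // subsetI soP.
Qed.

End Theory.

(** * Euclidean reflections *)

Section Reflections.
Local Open Scope ring_scope.
Variables (R : realFieldType) (n : nat).
Implicit Types (u v a b : 'rV[R]_n) (M : 'M[R]_n).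

Lemma dotE u v : u *m v^T = (dot u v)%:M.
Proof. exact: mx11_scalar. Qed.

Lemma dotZl k u a : dot (k *: u) a = k * dot u a.
Proof. by rewrite /dot -scalemxAl mxE. Qed.

Lemma dotC u v : dot u v = dot v u.
Proof.
by rewrite /dot (_ : u *m v^T = (v *m u^T)^T) ?mxE // trmx_mul trmxK.
Qed.

Lemma dot_sumr (I : Type) (r : seq I) (F : I -> 'rV[R]_n) u :
  dot u (\sum_(i <- r) F i) = \sum_(i <- r) dot u (F i).
Proof. by rewrite /dot raddf_sum mulmx_sumr summxE. Qed.

Lemma dotMnr u a k : dot u (a *+ k) = dot u a *+ k.
Proof. by rewrite dotC -scaler_nat dotZl mulr_natl dotC. Qed.

Lemma dot_gt0 a : a != 0 -> 0 < dot a a.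
Proof.
move=> a0; rewrite lt_neqAle eq_sym; apply/andP; split.
  apply: contraNneq a0 => d0; apply/eqP/rowP => j; rewrite mxE.
  move: d0; rewrite /dot mxE => /eqP; rewrite psumr_eq0 => [|i _]; last first.
    by rewrite mxE -expr2 sqr_ge0.
  by move/allP/(_ j (mem_index_enum _)); rewrite mxE mulf_eq0 orbb => /eqP.
by rewrite /dot mxE sumr_ge0 // => i _; rewrite mxE -expr2 sqr_ge0.
Qed.

Lemma act_reflection v a : v *m reflection a = v - cartan v a *: a.
Proof.
rewrite /reflection mulmxBr mulmx1 -scalemxAr mulmxA dotE mul_scalar_mx scalerA.
by rewrite /cartan mulrAC.
Qed.

Lemma reflection_self a : a != 0 -> a *m reflection a = - a.
Proof.
move=> /dot_gt0/lt0r_neq0 d; rewrite act_reflection /cartan mulfK //.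
by rewrite scaler_nat mulr2n opprD addNKr.
Qed.

Lemma tr_reflection a : (reflection a)^T = reflection a.
Proof. by rewrite /reflection linearB linearZ /= trmx1 trmx_mul trmxK. Qed.

Lemma reflectionN a : reflection (- a) = reflection a.
Proof.
have t : (- a)^T = - a^T by rewrite linearN.
by rewrite /reflection /dot t !(mulNmx, mulmxN) !opprK.
Qed.

Lemma reflection_sq a : a != 0 -> reflection a *m reflection a = 1%:M.
Proof.
move=> a0; apply/row_matrixP => i; rewrite !rowE mulmx1 mulmxA.
by rewrite (act_reflection (delta_mx _ _)) mulmxBl -scalemxAl reflection_self //
  act_reflection scalerN opprK subrK.
Qed.

Lemma reflection_orthogonal a : a != 0 -> reflection a *m (reflection a)^T = 1%:M.
Proof. by move=> a0; rewrite tr_reflection reflection_sq. Qed.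

Lemma conj_reflection M a : M *m M^T = 1%:M ->
  M^T *m reflection a *m M = reflection (a *m M).
Proof.
move=> MM; have MM' := mulmx1C MM.
have d : dot (a *m M) (a *m M) = dot a a.
  by rewrite /dot trmx_mul -mulmxA (mulmxA M) MM mul1mx.
rewrite /reflection d {d}.
rewrite mulmxBr mulmxBl mulmx1 MM' -scalemxAr -scalemxAl trmx_mul.
by rewrite !mulmxA.
Qed.
End Reflections.

(** * The geometric action of a Weyl group *)

Section WeylGroup.
Local Open Scope ring_scope.
Variables (R : realFieldType) (n : nat) (Phi Delta : seq 'rV[R]_n).
Variables (gT : finGroupType) (W : {group gT}) (S : {set gT}).
Variable rho : gT -> 'M[R]_n.
Hypotheses (rs : root_system Phi) (rb : root_base Phi Delta).
Hypothesis wr : weyl_realization Phi Delta W S rho.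
Implicit Types (u v a b : 'rV[R]_n) (g s t : gT).

Local Notation simple := (in_tuple Delta).

(** Linear independence and reducedness make the index unique. An element matching no simple root
    gets [None], hence zero root and coordinates. *)
Definition simple_index s : option 'I_(size Delta) :=
  [pick i : 'I_(size Delta) | rho s == reflection Delta`_i].
Definition simple_root s : 'rV[R]_n := oapp (fun i : 'I_(size Delta) => Delta`_i) 0
  (simple_index s).
Definition simple_coord v s : R := oapp (fun i : 'I_(size Delta) => coord simple i
  v) 0 (simple_index s).

Lemma simple_free : free simple.
Proof. exact: basis_free (base_basis rb). Qed.

Lemma coord_simple (i j : 'I_(size Delta)) : coord simple i Delta`_j = (i == j)%:R.
Proof. by rewrite (coord_free _ _ simple_free) eq_sym. Qed.

Lemma simple_mem (i : 'I_(size Delta)) : Delta`_i \in Phi.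
Proof. by apply: (base_sub rb); rewrite mem_nth. Qed.

Lemma root_neq0P a : a \in Phi -> a != 0.
Proof. by move=> aP; apply: contraNneq (root_neq0 rs) => <-. Qed.

Lemma simple_expand v : v = \sum_(i < size Delta) coord simple i v *: Delta`_i.
Proof. by apply: coord_span; rewrite (span_basis (base_basis rb)) memvf. Qed.

Lemma coord_inj v : (forall i, coord simple i v = 0) -> v = 0.
Proof.
by move=> h; rewrite (simple_expand v) big1 // => i _; rewrite h scale0r.
Qed.

(** The reflection in [a] sends [a] to [- a], the one in [b] to [a - cartan a b *: b]; so [a] is a
    multiple of [b], and the root system is reduced. *)
Lemma reflection_inj a b : a \in Phi -> b \in Phi ->
  reflection a = reflection b -> a = b \/ a = - b.
Proof.
move=> aP bP e; have := reflection_self (root_neq0P aP).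
rewrite e act_reflection => /eqP; rewrite subr_eq addrC -subr_eq opprK -mulr2n
  -scaler_nat.
move=> /eqP ea; have {}ea : a = (2^-1 * cartan a b) *: b.
  by rewrite -scalerA -ea scalerA mulVf ?scale1r ?pnatr_eq0.
have := aP; rewrite ea => /(root_reduced rs bP)[] ->; [left | right].
  by rewrite scale1r.
by rewrite scaleN1r.
Qed.

Lemma rootN a : a \in Phi -> - a \in Phi.
Proof. by move=> aP; rewrite -reflection_self ?root_neq0P ?(root_reflection rs). Qed.

Lemma simple_index_reflection s (i : 'I_(size Delta)) : rho s = reflection Delta`_i
  -> simple_index s = Some i.
Proof.
move=> e; rewrite /simple_index; case: pickP => [j /eqP ej | /(_ i)]; last first.
  by rewrite e eqxx.
have : reflection Delta`_i = reflection Delta`_j by rewrite -e -ej.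
move/(reflection_inj (simple_mem i) (simple_mem j)) => e'.
have := coord_simple i i; rewrite eqxx; case: e' => ->.
  by rewrite coord_simple; case: eqP => [-> // | _ /eqP]; rewrite eq_sym oner_eq0.
rewrite linearN /= coord_simple; case: eqP => [-> // | _ /eqP].
by rewrite oppr0 eq_sym oner_eq0.
Qed.

Lemma simple_ind s : s \in S ->
  exists i : 'I_(size Delta), [/\ s \in W, simple_index s = Some i & rho s =
    reflection Delta`_i].
Proof.
rewrite (rho_simple wr) inE => /andP[sW /mapP[a aD e]].
have i : (index a Delta < size Delta)%N by rewrite index_mem.
exists (Ordinal i); have {}e : rho s = reflection Delta`_(Ordinal i) by rewrite /=
  nth_index.
by split=> //; apply: simple_index_reflection.
Qed.

Lemma simple_onto i : exists2 s, s \in S & simple_index s = Some i.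
Proof.
have [s sW e] := rho_onto wr (simple_mem i); exists s.
  by rewrite (rho_simple wr) inE sW e map_f ?mem_nth.
exact: simple_index_reflection.
Qed.

Lemma simple_inW s : s \in S -> s \in W.
Proof. by case/simple_ind=> i []. Qed.

Lemma rhoM g h : g \in W -> h \in W -> rho (g * h)%g = rho g *m rho h.
Proof. exact: (rho_mul wr). Qed.

(** So far [W] is only known to be generated by the reflections in all roots, so facts on [rho] go
    by induction along words in these. *)
Lemma reflection_ind (P : gT -> Prop) : P 1%g ->
  (forall s g, s \in W -> g \in W -> P g ->
     (exists2 b, b \in Phi & rho s = reflection b) -> P (s * g)%g) ->
  forall g, g \in W -> P g.
Proof.
move=> P1 PM g gW; have := gW; rewrite {1}(rho_gen wr) => /gen_word[c + e].
rewrite e {g gW e}; elim: c => [|s c IH] cW; first by rewrite big_nil.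
have := cW s (mem_head _ _); rewrite inE => /andP[sW /mapP[b bP e]].
have c'W : {subset c <= [set x in W | rho x \in map (@reflection R n) Phi]}.
  by move=> t tc; apply: cW; rewrite inE tc orbT.
rewrite big_cons; apply: (PM _ _ sW _ (IH c'W)); last by exists b.
by rewrite (rho_gen wr) word_gen.
Qed.

Lemma rho_orthogonal g : g \in W -> rho g *m (rho g)^T = 1%:M.
Proof.
move: g; apply: reflection_ind => [|s g sW gW IH [b bP e]].
  by rewrite (rho_one wr) trmx1 mulmx1.
rewrite rhoM // trmx_mul mulmxA -(mulmxA (rho s)) IH mulmx1 e.
by rewrite reflection_orthogonal ?root_neq0P.
Qed.

Lemma rho_root g a : g \in W -> a \in Phi -> a *m rho g \in Phi.
Proof.
move=> gW; move: g gW a; apply: reflection_ind => [|s g sW gW IH [b bP e]] a aP.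
  by rewrite (rho_one wr) mulmx1.
by rewrite rhoM // mulmxA IH // e (root_reflection rs).
Qed.

Lemma rhoV g : g \in W -> rho g^-1 = (rho g)^T.
Proof.
move=> gW; rewrite -[LHS]mulmx1 -(rho_orthogonal gW) mulmxA -rhoM ?groupV //.
by rewrite mulVg (rho_one wr) mul1mx.
Qed.

Lemma rho_conj g s b : g \in W -> s \in W -> rho s = reflection b ->
  rho (s ^ g)%g = reflection (b *m rho g).
Proof.
move=> gW sW e; rewrite conjgE !rhoM ?groupM ?groupV // rhoV // e mulmxA.
by rewrite conj_reflection ?rho_orthogonal.
Qed.

(* A positive root that is not simple has positive inner product with some simple
   root in its support; reflecting in that root decreases the height. *)
Lemma reflection_gen b : b \in Phi -> exists2 y, y \in <<S>>%g & rho y = reflection b.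
Proof.
have SW : <<S>>%g \subset W by rewrite gen_subG; apply/subsetP => s /simple_inW.
have coordE (c : 'I_(size Delta) -> nat) (j : 'I_(size Delta)) :
    coord simple j (\sum_(i < size Delta) Delta`_i *+ c i) = (c j)%:R.
  rewrite linear_sum (bigD1 j) //= linearMn /= coord_simple eqxx big1 ?addr0 //.
  by move=> i ij; rewrite linearMn /= coord_simple eq_sym (negPf ij) mul0rn.
have pos m (c : 'I_(size Delta) -> nat) a : a \in Phi ->
    a = \sum_(i < size Delta) Delta`_i *+ c i -> (\sum_i c i < m)%N ->
    exists2 y, y \in <<S>>%g & rho y = reflection a.
  elim: m c a => // m IH c a aP ea lem.
  (* Otherwise no simple root would contribute positively to [dot a a], which is positive. *)
  have [i gt] : exists i : 'I_(size Delta), 0 < dot a Delta`_i *+ c i.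
    apply/existsP; apply: contraLR (dot_gt0 (root_neq0P aP)) => /existsPn h.
    rewrite -leNgt {2}ea dot_sumr sumr_le0 // => i _.
    by rewrite dotMnr leNgt h.
  have ci : (0 < c i)%N by case: (c i) gt => //; rewrite mulr0n ltxx.
  rewrite pmulrn_lgt0 // in gt.
  have [s sS es] := simple_onto i.
  have [i' [sW es' e]] := simple_ind sS.
  move: es' e; rewrite es => -[<-] e {i'}.
  have [-> | ne] := eqVneq a Delta`_i; first by exists s; rewrite ?mem_gen.
  have a'P : a *m reflection Delta`_i \in Phi.
    by rewrite (root_reflection rs) ?simple_mem.
  have k0 : 0 < cartan a Delta`_i.
    by rewrite /cartan divr_gt0 ?mulr_gt0 ?dot_gt0 ?root_neq0P ?simple_mem.
  have ca' (j : 'I_(size Delta)) : coord simple j (a *m reflection Delta`_i) =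
      (c j)%:R - cartan a Delta`_i * (j == i)%:R.
    by rewrite act_reflection linearB linearZ /= coord_simple {1}ea coordE.
  (* Only the coordinate at [i] changes, and it drops. If the new root is positive, its height is
     smaller. If it is negative, the other coordinates vanish, so [a] is a multiple of the simple
     root and by reducedness equal to it. *)
  have [c' [ea' | ea']] := base_sign rb a'P.
    have [y yS ey] : exists2 y, y \in <<S>>%g & rho y = reflection (a *m reflection
      Delta`_i).
      apply: (IH c' _ a'P ea'); rewrite -ltnS; apply: leq_trans lem; rewrite ltnS.
      have ec (j : 'I_(size Delta)) : j != i -> c' j = c j.
        move=> ji; apply/eqP; rewrite -(eqr_nat R) -coordE -ea' ca' (negPf ji).
        by rewrite mulr0 subr0.
      rewrite (bigD1 i) //= [X in (_ < X)%N](bigD1 i) //= (eq_bigr _ ec) ltn_add2r.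
      by rewrite -(ltr_nat R) -coordE -ea' ca' eqxx mulr1 gtrBl.
    exists (y ^ s)%g; first by rewrite groupJ // mem_gen.
    rewrite (rho_conj sW (subsetP SW _ yS) ey) e -mulmxA reflection_sq ?mulmx1 //.
    by rewrite root_neq0P ?simple_mem.
  have ec (j : 'I_(size Delta)) : j != i -> c j = 0%N.
    move=> ji; apply/eqP; rewrite -(eqr_nat R) eq_le ler0n andbT.
    have := ca' j; rewrite (negPf ji) mulr0 subr0 => <-.
    by rewrite ea' linearN /= coordE oppr_le0 ler0n.
  have ea1 : a = (c i)%:R *: Delta`_i.
    rewrite {1}ea (bigD1 i) //= big1 ?addr0 ?scaler_nat // => j /ec ->.
    by rewrite mulr0n.
  have := aP; rewrite {1}ea1 => /(root_reduced rs (simple_mem i))[e1 | e1].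
    by case/eqP: ne; rewrite ea1 e1 scale1r.
  by have := ler0n R (c i); rewrite e1 oppr_ge0 ler10.
move=> bP; have [c [eb | eb]] := base_sign rb bP; first exact: pos eb (ltnSn _).
rewrite -reflectionN; apply: (pos _ c _ (rootN bP) _ (ltnSn _)).
by rewrite eb opprK.
Qed.

Lemma gen_simple : W :=: <<S>>%g.
Proof.
apply/eqP; rewrite eqEsubset [X in _ && X]gen_subG; apply/andP; split; last first.
  by apply/subsetP => s /simple_inW.
rewrite {1}(rho_gen wr) gen_subG; apply/subsetP => x.
rewrite inE => /andP[xW /mapP[b bP e]].
have [y yS ey] := reflection_gen bP.
have yW : y \in W by apply: subsetP yS; rewrite gen_subG;
  apply/subsetP => s /simple_inW.
by rewrite (rho_inj wr xW yW) // e ey.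
Qed.

(** As [rho g] is orthogonal, a row vector times [rho g] is its image under [g^-1]. The goals follow
    the order of the fields. *)
Lemma weyl_geometric_action :
  geometric_action W S (fun v => v \in Phi) (fun v g => v *m rho g)
    simple_root simple_coord.
Proof.
split.
- exact: gen_simple.
- move=> s sS; have [i [sW _ e]] := simple_ind sS.
  apply: (rho_inj wr); rewrite ?groupM //.
  by rewrite rhoM // e (rho_one wr) reflection_sq ?root_neq0P ?simple_mem.
- by move=> g k u v gW; rewrite mulmxDl scalemxAl.
- by move=> v; rewrite (rho_one wr) mulmx1.
- by move=> v g h gW hW; rewrite rhoM // mulmxA.
- move=> k u v s; rewrite /simple_coord; case: (simple_index s) => [i|] /=.
    by rewrite linearP.
  by rewrite mulr0 addr0.
- move=> v h; apply: coord_inj => i; have [s sS e] := simple_onto i.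
  by have := h s sS; rewrite /simple_coord e.
- move=> s t sS tS; have [i [sW es rs1]] := simple_ind sS.
  have [j [tW et rt]] := simple_ind tS.
  rewrite /simple_coord /simple_root es et /= coord_simple.
  congr (_ %:R); congr (nat_of_bool _); apply/eqP/eqP => [eij | est].
    by apply: (rho_inj wr) => //; rewrite rs1 rt eij.
  by have := es; rewrite est et => -[].
- move=> s sS; have [i [sW es e]] := simple_ind sS.
  by rewrite /simple_root es /= e reflection_self ?root_neq0P ?simple_mem.
- move=> v s t sS tS ts; have [i [sW es e]] := simple_ind sS.
  have [j [tW et e']] := simple_ind tS.
  rewrite e act_reflection /simple_coord et /= linearB linearZ /= coord_simple.
  case: eqP => [eji | _]; last by rewrite mulr0 subr0.
  by case/eqP: ts; apply: (rho_inj wr) => //; rewrite e e' eji.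
- exact/negP/(root_neq0 rs).
- exact: rootN.
- move=> s sS; have [i [sW es e]] := simple_ind sS.
  by rewrite /simple_root es simple_mem.
- by move=> v g gW vP; apply: rho_root.
- move=> v vP; have [c [ev | ev]] := base_sign rb vP; [left | right] => s sS.
    rewrite /simple_coord; case: (simple_index s) => //= i.
    rewrite ev linear_sum sumr_ge0 // => j _.
    by rewrite linearMn /= coord_simple mulrn_wge0 ?ler0n.
  rewrite /simple_coord; case: (simple_index s) => //= i.
  rewrite ev linearN oppr_le0 linear_sum sumr_ge0 // => j _.
  by rewrite linearMn /= coord_simple mulrn_wge0 ?ler0n.
- move=> v s vP sS h; have [i [sW es e]] := simple_ind sS.
  have ev : v = coord simple i v *: Delta`_i.
    rewrite {1}(simple_expand v) (bigD1 i) //= big1 ?addr0 // => j ji.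
    have [t tS et] := simple_onto j; have := h t tS; rewrite /simple_coord et /=.
    move=> -> //; first by rewrite scale0r.
    by apply: contraNneq ji => ets; move: et; rewrite ets es => -[->].
  rewrite /simple_root es /=; have := vP; rewrite {1}ev.
  case/(root_reduced rs (simple_mem i)) => ek; [left | right].
    by rewrite ev ek scale1r.
  by rewrite ev ek scaleN1r.
- move=> s t g sS tS gW; have [i [sW es e]] := simple_ind sS.
  have [j [tW et e']] := simple_ind tS; rewrite /simple_root es et /=.
  have rr := rho_root gW (simple_mem i).
  split=> [est | h].
    by apply: (reflection_inj rr (simple_mem j)); rewrite -e' -est (rho_conj gW sW e).
  apply: (rho_inj wr); rewrite ?groupJ // (rho_conj gW sW e) e'.
  by case: h => ->; rewrite ?reflectionN.
Qed.
End WeylGroup.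

(** * The lattice of a family of sets closed under intersection and union *)

(* The closure proofs are arguments of the type so that the lattice structure can be
   attached to it. *)
Definition set_sublattice (T : finType) (F : {set {set T}})
    (FI : {in F &, forall A B, A :&: B \in F})
    (FU : {in F &, forall A B, A :|: B \in F}) : Type :=
  {A : {set T} | A \in F}.

Section SetSublattice.
Variables (T : finType) (F : {set {set T}}).
Hypothesis FI : {in F &, forall A B, A :&: B \in F}.
Hypothesis FU : {in F &, forall A B, A :|: B \in F}.

Local Notation L := (set_sublattice FI FU).

HB.instance Definition _ := Choice.copy L {A : {set T} | A \in F}.

Implicit Types A B C : L.
Definition sub_le A B := val A \subset val B.
Definition sub_meet A B : L := exist _ (val A :&: val B) (FI (valP A) (valP B)).
Definition sub_join A B : L := exist _ (val A :|: val B) (FU (valP A) (valP B)).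

Lemma sub_leE A B : sub_le A B = (sub_meet A B == A).
Proof. by rewrite -(inj_eq val_inj) /= (sameP eqP setIidPl). Qed.
Lemma sub_meetC : commutative sub_meet.
Proof. by move=> A B; apply/val_inj/setIC. Qed.
Lemma sub_joinC : commutative sub_join.
Proof. by move=> A B; apply/val_inj/setUC. Qed.
Lemma sub_meetA : associative sub_meet.
Proof. by move=> A B C; apply/val_inj/setIA. Qed.
Lemma sub_joinA : associative sub_join.
Proof. by move=> A B C; apply/val_inj/setUA. Qed.
Lemma sub_joinKI B A : sub_meet A (sub_join A B) = A.
Proof. by apply: val_inj; rewrite /= setUC setKU. Qed.
Lemma sub_meetKU B A : sub_join A (sub_meet A B) = A.
Proof. by apply: val_inj; rewrite /= setIC setKI. Qed.
Lemma sub_meetUl : left_distributive sub_meet sub_join.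
Proof. by move=> A B C; apply/val_inj/setIUl. Qed.
Lemma sub_meetxx : idempotent_op sub_meet.
Proof. by move=> A; apply/val_inj/setIid. Qed.

HB.instance Definition _ := Order.isMeetJoinDistrLattice.Build
  (Order.Disp tt tt) L sub_leE (fun _ _ => erefl) sub_meetC sub_joinC
  sub_meetA sub_joinA sub_joinKI sub_meetKU sub_meetUl sub_meetxx.

(** The order is put on the subtype itself, so the identity is the isomorphism. *)
Lemma set_sublattice_distributive : distributive_lattice_by_inclusion F.
Proof.
exists (Order.Disp tt tt), (L : distrLatticeType _), id.
by split; first exists id.
Qed.
End SetSublattice.

Theorem theorem1p2 (gT : finGroupType) (W : {group gT}) (S : {set gT})
    (hW : finite_weyl_group W S) (w : gT) (hw : w \in W) :
  (forall J K : {set gT}, J \in BP W S w -> K \in BP W S w ->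
     J :&: K \in BP W S w /\ J :|: K \in BP W S w) /\
  distributive_lattice_by_inclusion (BP W S w).
Proof.
case: hW => R [n [Phi [Delta [rho [rs rb wr]]]]].
have ga := weyl_geometric_action rs rb wr.
split=> [J K hJ hK | ].
  by split; [apply: (BP_setI ga) | apply: (BP_setU ga)].
apply: set_sublattice_distributive => J K hJ hK; first exact: (BP_setI ga).
exact: (BP_setU ga).
Qed.
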